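(* Let $\mathbf{X}$ be a Hunt process on $E$ associated with a lower bounded regular semi-Dirichlet form $(\mathscr{E},\mathscr{F})$ on $L^2(E;\mathfrak{m})$, and let $\{T_t\}_{t\ge0}$ be the associated semigroup on $L^2(E;\mathfrak{m})$. Assume that the resolvent $\{R_\alpha\}_{\alpha>0}$ of $\mathbf{X}$ has the strong Feller property, and that $\|T_t\|_{L^2(E;\mathfrak{m})\to L^\infty(E;\mathfrak{m})}$ is finite for any $t>0$. In addition, assume that either of the following conditions is satisfied: (i) $\mathfrak{m}(E)$ is finite; (ii) for any $t>0$, $P_t\mathbf{1}_E$ is continuous on $E$. Then the semigroup $\{P_t\}_{t\ge0}$ of $\mathbf{X}$ has the strong Feller property.
   Context: $(E,d)$ is a locally compact separable metric space with one-point compactification $E_\partial=E\cup\{\partial\}$, and $\mathfrak{m}$ is a positive Radon measure on $E$ with full topological support. For a Hunt process $\mathbf{X}=(\{X_t\}_{t\in[0,+\infty]},\{\mathbf{P}_x\}_{x\in E_\partial})$ on $E$ (functions extended by $f(\partial)=0$), $P_tf(x)=\mathbf{E}_x[f(X_t)]$ and $R_\alpha f(x)=\int_0^\infty e^{-\alpha t}P_tf(x)\,dt$ for $f$ in the set $\mathscr{B}_b(E)$ of bounded Borel functions. $\{P_t\}$ (resp. $\{R_\alpha\}$) has the strong Feller property if $P_tf$ (resp. $R_\alpha f$) is bounded continuous on $E$ for all $f\in\mathscr{B}_b(E)$ and all $t>0$ (resp. $\alpha>0$). Lower bounded semi-Dirichlet form $(\mathscr{E},\mathscr{F})$ on $L^2(E;\mathfrak{m})$: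 $\mathscr{F}$ is a dense linear subspace of $L^2(E;\mathfrak{m})$ and $\mathscr{E}:\mathscr{F}\times\mathscr{F}\to\mathbb{R}$ is bilinear such that, with $\mathscr{E}_\alpha(u,v)=\mathscr{E}(u,v)+\alpha(u,v)_{L^2(E;\mathfrak{m})}$, for some constant $\alpha_0\ge0$: (1) $\mathscr{E}_{\alpha_0}(u,u)\ge0$ for all $u\in\mathscr{F}$; (2) there is $K\ge1$ with $|\mathscr{E}(u,v)|\le K\mathscr{E}_{\alpha_0}(u,u)^{1/2}\mathscr{E}_{\alpha_0}(v,v)^{1/2}$ for all $u,v\in\mathscr{F}$; (3) $\mathscr{F}$ is a Hilbert space relative to the inner product $\frac12(\mathscr{E}_\alpha(u,v)+\mathscr{E}_\alpha(v,u))$ for all $\alpha>\alpha_0$; (4) for all $u\in\mathscr{F}$ and $a\ge0$, $u\wedge a\in\mathscr{F}$ and $\mathscr{E}(u\wedge a,u-u\wedge a)\ge0$. It is regular if $\mathscr{F}\cap C_0(E)$ is dense in $\mathscr{F}$ with respect to $\mathscr{E}_{\alpha_0+1}^{1/2}$ and uniformly dense in $C_0(E)$ (continuous functions with compact support). Such a form determines a strongly continuous semigroup $\{T_t\}_{t\ge0}$ on $L^2(E;\mathfrak{m})$ with $\|T_t\|_{L^2\to L^2}\le e^{\alpha_0t}$, whose resolvent $G_\alpha f=\int_0^\infty e^{-\alpha t}T_tf\,dt$, $\alpha>\alpha_0$, satisfies $\mathscr{E}_\alpha(G_\alpha f,u)=(f,u)_{L^2(E;\mathfrak{m})}$ for all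 $f\in L^2(E;\mathfrak{m})$, $u\in\mathscr{F}$. $\{T_t\}$ is sub-Markov and it, as well as $G_\alpha$ for all $\alpha>0$, extends (by monotone limits) to $L^\infty(E;\mathfrak{m})$. $\mathbf{X}$ is associated with $(\mathscr{E},\mathscr{F})$ if $R_\alpha u=G_\alpha u$ $\mathfrak{m}$-a.e. for each $\alpha>0$ and each bounded Borel $u$; then $P_tu$ is an $\mathfrak{m}$-version of $T_tu$ for Borel $u\in L^2(E;\mathfrak{m})$, $t>0$. *)

(* Defs.v *)
From HB Require Import structures.
From mathcomp Require Import all_boot all_order all_algebra.
From mathcomp Require Import all_classical all_reals all_analysis.
From mathcomp Require Import measurable_realfun.

Set Implicit Arguments.
Unset Strict Implicit.
Unset Printing Implicit Defensive.

Import Order.TTheory GRing.Theory Num.Theory.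
Import numFieldNormedType.Exports.

Local Open Scope classical_set_scope.
Local Open Scope ring_scope.

(* Measurable types are pointed in the library, so the state space E carries a
   base point, which plays no role besides making E nonempty. *)
#[short(type="pmetricType")]
HB.structure Definition PointedMetric (R : numDomainType) :=
  {M of Metric R M & isPointed M}.

Notation borel T := (g_sigma_algebraType (@open T)).
Notation opc := one_point_compactification.

Definition separable (T : topologicalType) : Prop :=
  exists2 D : set T, countable D & dense D.

Section state_space.
Context {R : realType} {E : pmetricType R}.

Definition bounded_borel (f : E -> R) : Prop :=
  measurable_fun [set: borel E] (f : borel E -> R) /\
  [bounded f x | x in [set: E]].

(* C_0(E) denotes the continuous functions with compact support. *)
Definition C0 : set (E -> R) :=
  [set f | continuous f /\ compact (closure [set x | f x != 0])].

(* On a locally compact separable metric space a Borel measure finite on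
   compact sets is automatically regular. *)
Definition radon (m : {measure set (borel E) -> \bar R}) : Prop :=
  forall K : set E, compact K -> (m K < +oo)%E.

Definition full_support (m : {measure set (borel E) -> \bar R}) : Prop :=
  forall U : set E, open U -> U !=set0 -> (0 < m U)%E.

(* The strong Feller property of one operator S on bounded Borel functions. *)
Definition strong_feller (S : (E -> R) -> E -> R) : Prop :=
  forall f, bounded_borel f ->
    continuous (S f) /\ [bounded S f x | x in [set: E]].

Definition ext0 (f : E -> R) (y : opc E) : R := if y is Some x then f x else 0.

End state_space.

Section hunt.
Context {R : realType} {E : pmetricType R}.
Context {d : measure_display} {Omega : measurableType d}.
(* Only the values X t with 0 <= t <= +oo are relevant. *)
Variables (X : \bar R -> Omega -> opc E) (P : opc E -> probability Omega R).

Definition lifetime (w : Omega) : \bar R :=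
  ereal_inf [set t | (0 <= t)%E /\ X t w = None].

Section filtration.
Variable Ft : R -> set (set Omega).

Definition stopping_time (tau : Omega -> \bar R) : Prop :=
  (forall w, (0 <= tau w)%E) /\
  (forall t : R, 0 <= t -> Ft t [set w | (tau w <= t%:E)%E]).

Definition stopped (tau : Omega -> \bar R) : set (set Omega) :=
  [set A | d.-measurable A /\
    forall t : R, 0 <= t -> Ft t (A `&` [set w | (tau w <= t%:E)%E])].

Record admissible_filtration : Prop := AdmissibleFiltration {
  filt_sigma : forall t : R, 0 <= t -> sigma_algebra [set: Omega] (Ft t) ;
  filt_sub : forall t : R, 0 <= t -> Ft t `<=` d.-measurable ;
  filt_mono : forall s t : R, 0 <= s -> s <= t -> Ft s `<=` Ft t ;
  filt_right : forall t : R, 0 <= t ->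
    \bigcap_(s in [set s : R | t < s]) Ft s `<=` Ft t ;
  filt_adapted : forall (t : R) (B : set (borel (opc E))), 0 <= t ->
    measurable B -> Ft t (X t%:E @^-1` B) }.

(* The strong Markov property and quasi-left-continuity are stated under every
   P x, x in opc E; for an arbitrary initial law mu, they follow by integrating
   with respect to mu(dx). The simple Markov property is the case of a constant
   stopping time. *)
Record hunt_process_wrt : Prop := HuntProcessWrt {
  hunt_filt : admissible_filtration ;
  hunt_meas : forall (t : R) (B : set (borel (opc E))), 0 <= t ->
    measurable B ->
    measurable_fun [set: borel (opc E)]
      (fun x : borel (opc E) => P x (X t%:E @^-1` B)) ;
  hunt_normal : forall x : E, P (Some x) [set w | X 0%E w = Some x] = 1%E ;
  hunt_cemetery : forall t : R, 0 <= t ->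
    P None [set w | X t%:E w = None] = 1%E ;
  hunt_infty : forall w, X +oo%E w = None ;
  hunt_lifetime : forall w t, (lifetime w <= t)%E -> X t w = None ;
  hunt_shift : forall t : \bar R, (0 <= t)%E -> exists theta : Omega -> Omega,
    forall (s : \bar R) w, (0 <= s)%E -> X s (theta w) = X (s + t)%E w ;
  hunt_right_cont : forall w (t : R), 0 <= t ->
    X s%:E w @[s --> t^'+] --> X t%:E w ;
  hunt_left_lim : forall w (t : R), 0 < t ->
    exists l : opc E, X s%:E w @[s --> t^'-] --> l ;
  hunt_strong_markov : forall (x : opc E) tau (s : R) A (B : set (borel (opc E))),
    stopping_time tau -> 0 <= s -> stopped tau A -> measurable B ->
    P x (A `&` [set w | B (X (tau w + s%:E)%E w)]) =
    (\int[P x]_(w in A) P (X (tau w) w) (X s%:E @^-1` B))%E ;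
  hunt_quasi_left : forall (x : opc E) (tau_ : nat -> Omega -> \bar R),
    (forall n, stopping_time (tau_ n)) ->
    (forall n w, (tau_ n w <= tau_ n.+1 w)%E) ->
    let tau w := ereal_sup (range (tau_ ^~ w)) in
    {ae P x, forall w, (tau w < +oo)%E ->
      X (tau_ n w) w @[n --> \oo] --> X (tau w) w} }.

End filtration.

Definition hunt_process : Prop := exists Ft, hunt_process_wrt Ft.

Definition transition (t : R) (f : E -> R) (x : E) : R :=
  \int[P (Some x)]_w ext0 f (X t%:E w).

Definition resolvent (alpha : R) (f : E -> R) (x : E) : R :=
  \int[lebesgue_measure]_(t in `[0, +oo[)
    (expR (- (alpha * t)) * transition t f x).

End hunt.

(* Elements of L^2(E; m) are represented by square-integrable Borel functions;
   all notions below are invariant under m-a.e. equality. *)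
Section forms.
Context {R : realType} {E : pmetricType R}.
Variable m : {measure set (borel E) -> \bar R}.

Local Notation L2 := [set u : E -> R | (u : borel E -> R) \in Lfun m 2%:E].

Definition aeq (u v : E -> R) : Prop := {ae m, forall x : borel E, u x = v x}.

Definition ip (u v : E -> R) : R := \int[m]_x (u x * v x).

Definition Lpnorm (p : \bar R) (u : E -> R) : \bar R :=
  Lnorm m p (fun x : borel E => (u x)%:E).

(* Operator norm from L^2 to L^q. *)
Definition opnorm2 (q : \bar R) (S : (E -> R) -> E -> R) : \bar R :=
  ereal_sup [set Lpnorm q (S f) | f in
    [set f | L2 f /\ (Lpnorm 2%:E f <= 1)%E]].

Section form.
Variables (F : set (E -> R)) (Ef : (E -> R) -> (E -> R) -> R).

Definition form_shift (alpha : R) (u v : E -> R) : R := Ef u v + alpha * ip u v.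

Definition form_sym (alpha : R) (u v : E -> R) : R :=
  2^-1 * (form_shift alpha u v + form_shift alpha v u).

Definition form_norm (alpha : R) (u : E -> R) : R :=
  Num.sqrt (form_shift alpha u u).

(* F modulo a.e. equality is a Hilbert space for the symmetric bilinear B. *)
Definition hilbert_on (B : (E -> R) -> (E -> R) -> R) : Prop :=
  let nB u := Num.sqrt (B u u) in
  [/\ forall u, F u -> 0 <= B u u,
      forall u, F u -> B u u = 0 -> aeq u (cst 0) &
      forall u_ : nat -> E -> R, (forall n, F (u_ n)) ->
        (forall e, 0 < e -> exists N, forall i j, (N <= i)%N -> (N <= j)%N ->
           nB (u_ i - u_ j) < e) ->
        exists2 u, F u & nB (u_ n - u) @[n --> \oo] --> (0 : R)].

Record lower_bounded_semi_dirichlet (alpha0 : R) : Prop :=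
  LowerBoundedSemiDirichlet {
  form_alpha0 : 0 <= alpha0 ;
  form_L2 : F `<=` L2 ;
  form_sat : forall u v, F u -> L2 v -> aeq u v -> F v ;
  form_ae : forall u u' v v', F u -> F u' -> F v -> F v' ->
    aeq u u' -> aeq v v' -> Ef u v = Ef u' v' ;
  form_dom0 : F (cst 0) ;
  form_dom : forall (a : R) u v, F u -> F v -> F (a *: u + v) ;
  form_dense : forall f, L2 f -> forall e : R, 0 < e ->
    exists2 u, F u & (Lpnorm 2%:E (f - u)%R < e%:E)%E ;
  form_linl : forall (a : R) u v w, F u -> F v -> F w ->
    Ef (a *: u + v) w = a * Ef u w + Ef v w ;
  form_linr : forall (a : R) u v w, F u -> F v -> F w ->
    Ef w (a *: u + v) = a * Ef w u + Ef w v ;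
  form_lower : forall u, F u -> 0 <= form_shift alpha0 u u ;
  form_sector : exists2 K : R, 1 <= K & forall u v, F u -> F v ->
    `|Ef u v| <= K * form_norm alpha0 u * form_norm alpha0 v ;
  form_hilbert : forall alpha, alpha0 < alpha -> hilbert_on (form_sym alpha) ;
  form_markov : forall u (a : R), F u -> 0 <= a ->
    let ua : E -> R := fun x => Num.min (u x) a in
    F ua /\ 0 <= Ef ua (u - ua) }.

Definition regular_form (alpha0 : R) : Prop :=
  (forall u, F u -> forall e : R, 0 < e ->
     exists2 v, (F `&` C0) v & form_norm (alpha0 + 1) (u - v) < e) /\
  (forall f, C0 f -> forall e : R, 0 < e ->
     exists2 v, (F `&` C0) v & forall x : E, `|f x - v x| < e).

Variable T : R -> (E -> R) -> E -> R.

(* h = \int_D e^(- alpha t) T_t f dt as an L^2-valued integral: t |-> T_t f is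
   L^2-continuous below, so the Bochner integral is the element characterized
   by its scalar products. *)
Definition time_integral (alpha : R) (D : set R) (f h : E -> R) : Prop :=
  L2 h /\ forall v, L2 v ->
    ip h v = \int[lebesgue_measure]_(t in D)
      (expR (- (alpha * t)) * ip (T t f) v).

Record semigroup_of_form (alpha0 : R) : Prop := SemigroupOfForm {
  sg_L2 : forall t f, 0 <= t -> L2 f -> L2 (T t f) ;
  sg_ae : forall t f g, 0 <= t -> L2 f -> L2 g -> aeq f g ->
    aeq (T t f) (T t g) ;
  sg_lin : forall t (a : R) f g, 0 <= t -> L2 f -> L2 g ->
    aeq (T t (a *: f + g)) (a *: T t f + T t g) ;
  sg_0 : forall f, L2 f -> aeq (T 0 f) f ;
  sg_D : forall s t f, 0 <= s -> 0 <= t -> L2 f ->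
    aeq (T (s + t) f) (T s (T t f)) ;
  sg_cont : forall f, L2 f ->
    Lpnorm 2%:E (T t f - f) @[t --> 0^'+] --> 0%E ;
  sg_norm : forall t, 0 <= t ->
    (opnorm2 2%:E (T t) <= (expR (alpha0 * t))%:E)%E ;
  sg_resolvent : forall alpha f, alpha0 < alpha -> L2 f ->
    exists g, [/\ time_integral alpha `[0, +oo[ f g, F g &
      forall u, F u -> form_shift alpha g u = ip f u] }.

(* g is an m-version of G_alpha f, alpha > 0, for a nonnegative f in L^infty:
   the monotone limit of \int_0^n e^(- alpha t) T_t f_n dt along nonnegative
   square-integrable f_n increasing to f. Truncating the time integral gives a
   meaning to G_alpha also for 0 < alpha <= alpha0, where the integral up to
   +oo need not converge in L^2; if alpha0 < alpha the limit is also that of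
   G_alpha f_n. *)
Definition Linfty_resolvent_ge0 (alpha : R) (f g : E -> R) : Prop :=
  exists f_ h_ : nat -> E -> R,
    [/\ forall n, L2 (f_ n),
        forall n x, 0 <= f_ n x <= f_ n.+1 x,
        forall x, f_ n x @[n --> \oo] --> f x,
        forall n, time_integral alpha `[0, n%:R] (f_ n) (h_ n) &
        {ae m, forall x : borel E, h_ n x @[n --> \oo] --> g x}].

Definition Linfty_resolvent (alpha : R) (f g : E -> R) : Prop :=
  exists g1 g2 : E -> R,
    [/\ Linfty_resolvent_ge0 alpha (f^\+) g1,
        Linfty_resolvent_ge0 alpha (f^\-) g2 & aeq g (g1 - g2)].

End form.
End forms.

Definition associated {R : realType} {E : pmetricType R}
    {d : measure_display} {Omega : measurableType d}
    (m : {measure set (borel E) -> \bar R})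
    (X : \bar R -> Omega -> opc E) (P : opc E -> probability Omega R)
    (T : R -> (E -> R) -> E -> R) : Prop :=
  forall (alpha : R) (u : E -> R), 0 < alpha -> bounded_borel u ->
    Linfty_resolvent m T alpha u (resolvent X P alpha u).

(* Main.v *)
Require Import Defs.
From HB Require Import structures.
From mathcomp Require Import all_boot all_order all_algebra.
From mathcomp Require Import all_classical all_reals all_analysis.
From mathcomp Require Import measurable_realfun ess_sup_inf ring lra.
Set Implicit Arguments.
Unset Strict Implicit.
Unset Printing Implicit Defensive.
Import Order.TTheory GRing.Theory Num.Theory.
Import numFieldNormedType.Exports.
Local Open Scope classical_set_scope.
Local Open Scope ring_scope.

(** Fix t > 0, let C be the norm of T_t from L2 to L^oo, and let L_b denote the
    Laplace transform at b, so that R_b f x = L_b (s |-> P_s f x) and, in the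
    weak sense, G_b f = L_b (s |-> T_s f).

    Continuity of P_t u for u in C0. The Laplace transforms of a function phi
    at large arguments determine those of the shifted function phi (. + t), by
    an explicit inversion formula (Phragmen) that is stable under integration
    over a parameter. Applied to s |-> P_s u x, integrated in x over a set A of
    finite measure, it turns the association of the process with the form into
      \int_A R_b (P_t u) dm = L_b (s |-> (T_(s + t) u, 1_A)),
    which is [resolvent_transition_integral]. As T_(s + t) u = T_t (T_s u) and
    T_s u tends to u in L2 as s decreases to 0, the pairing (T_(s + t) u, 1_A)
    differs from (T_t u, 1_A) by at most C |T_s u - u| m(A). By Abel's theorem
    for Laplace transforms, the integral of b R_b (P_t u) over A is within
    e m(A) of (T_t u, 1_A) once b is large, how large depending on e but not on
    A ([resolvent_transition_near]). The functions b R_b (P_t u) are continuous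
    because the resolvent is strong Feller; as every nonempty open set has
    positive measure, such bounds on their integrals are pointwise bounds
    ([full_support_le]). Hence they form a uniform Cauchy family as b tends to
    infinity. Their pointwise limit is P_t u, by right-continuity of the paths
    and Abel's theorem again. So P_t u is continuous, and the same comparison
    yields |P_t u| <= C |u|, |u| being the L2 norm ([transition_C0]).

    From C0 to bounded Borel functions. The bound |P_t u - P_t f| <= C |u - f|
    for all u in C0 defines a class of functions f ([controlled]) for which
    P_t f is a uniform limit of continuous functions, C0 being dense in L2. The
    class is stable under linear combinations and under pointwise limits
    dominated in L2, so by a monotone class argument it contains f 1_V for
    every bounded Borel f and every relatively compact open V. A bounded Borel
    f >= 0 is the increasing limit of such functions along an exhaustion of E,
    so that P_t f is lower semicontinuous. For general f with |f| <= M this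
    applies to M + f and to M - f; since P_t 1 is continuous, P_t f is both
    lower and upper semicontinuous. Continuity of P_t 1 is the hypothesis (ii),
    and under (i) the function 1 itself is a limit of indicators of relatively
    compact open sets dominated in L2. *)

(** * Limits under the integral sign *)
Lemma cvgn_le (R : realType) (u : R^nat) (l c : R) :
  u n @[n --> \oo] --> l -> (forall n, u n <= c) -> l <= c.
Proof.
move=> ul uc; rewrite -(cvg_lim _ ul)//.
by apply: limr_le; [exact: (cvgP _ ul)|exact: nearW].
Qed.

Section dominated_convergence.
Context d (T : measurableType d) (R : realType).
Variables (mu : {measure set T -> \bar R}) (D : set T) (mD : measurable D).

Lemma integrable_dominated (f g : T -> R) : measurable_fun D f ->
  mu.-integrable D (EFin \o g) -> (forall x, D x -> `|f x| <= g x) ->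
  mu.-integrable D (EFin \o f).
Proof.
move=> mf ig fg; apply: (le_integrable mD _ _ ig).
  exact/measurable_EFinP.
by move=> x Dx; rewrite /= lee_fin (le_trans (fg x Dx))// ler_norm.
Qed.

Lemma integrable_EFinD (f g : T -> R) : mu.-integrable D (EFin \o f) ->
  mu.-integrable D (EFin \o g) ->
  mu.-integrable D (EFin \o (fun x => f x + g x)).
Proof. by move=> if_ ig; exact: (integrableD mD if_ ig). Qed.

Lemma integrable_EFinB (f g : T -> R) : mu.-integrable D (EFin \o f) ->
  mu.-integrable D (EFin \o g) ->
  mu.-integrable D (EFin \o (fun x => f x - g x)).
Proof. by move=> if_ ig; exact: (integrableB mD if_ ig). Qed.

Lemma integrable_EFinZ (c : R) (f : T -> R) : mu.-integrable D (EFin \o f) ->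
  mu.-integrable D (EFin \o (fun x => c * f x)).
Proof. by move=> if_; exact: (integrableZl mD c if_). Qed.

Lemma Rintegral_dominated_cvg (f_ : nat -> T -> R) (f g : T -> R) :
  (forall n, measurable_fun D (f_ n)) ->
  (forall x, D x -> f_ n x @[n --> \oo] --> f x) ->
  mu.-integrable D (EFin \o g) ->
  (forall n x, D x -> `|f_ n x| <= g x) ->
  \int[mu]_(x in D) f_ n x @[n --> \oo] --> \int[mu]_(x in D) f x.
Proof.
move=> mf_ f_f ig fg.
have mf : measurable_fun D f by apply: measurable_fun_cvg mf_ f_f.
have lefg x : D x -> `|f x| <= g x.
  move=> Dx; apply: (@cvgn_le _ (fun n => `|f_ n x|)) => [|n]; last exact: fg.
  exact: cvg_norm (f_f x Dx).
have if_ := integrable_dominated mf ig lefg.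
apply: fine_cvg; rewrite fineK; last exact: integrable_fin_num.
apply: (@dominated_cvg _ _ _ mu D mD (fun n x => (f_ n x)%:E) (EFin \o f) (EFin \o g)) => //.
- by move=> n; exact/measurable_EFinP.
- by move=> x Dx; apply: cvg_EFin; [exact: nearW|exact: f_f].
Qed.

End dominated_convergence.

(** * Laplace transforms of functions of exponential growth *)
Section laplace.
Context (R : realType).
Implicit Types (a b c M : R) (phi : R -> R).
Local Notation mu := (@lebesgue_measure R).
Local Notation D := (`[0%R, +oo[%classic : set R).

Definition laplace b phi : R :=
  \int[mu]_(s in D) (expR (- (b * s)) * phi s).

Record exp_growth a M phi : Prop := ExpGrowth {
  growth_meas : measurable_fun D phi ;
  growth_le : forall s, 0 <= s -> `|phi s| <= M * expR (a * s) }.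

Lemma continuous_expRM c : continuous (fun s : R => expR (c * s)).
Proof.
move=> s; apply: (@continuous_comp _ _ _ ( *%R c) expR).
  exact: mulrl_continuous.
exact: continuous_expR.
Qed.

Lemma measurable_expRM c (A : set R) : measurable_fun A (fun s : R => expR (c * s)).
Proof.
apply: measurable_funTS; apply: continuous_measurable_fun.
exact: continuous_expRM.
Qed.

Lemma in_halfline (s : R) : D s <-> 0 <= s.
Proof. by rewrite /= in_itv/= andbT. Qed.

Lemma integral_expRN c : 0 < c ->
  mu.-integrable D (EFin \o (fun s => expR (- c * s))) /\
  \int[mu]_(s in D) expR (- c * s) = c^-1.
Proof.
move=> c0.
have ipdf := integrable_exponential_pdf c0.
have : mu.-integrable D (EFin \o exponential_pdf c).
  by apply: (integrableS _ _ _ ipdf) => //.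
have pdfE (s : R) : s \in D -> exponential_pdf c s = c * expR (- c * s).
  by move=> /set_mem/in_halfline; exact: exponential_pdfE.
move=> ipdfD.
have icD : mu.-integrable D (EFin \o (fun s => c * expR (- c * s))).
  apply: eq_integrable ipdfD => // s sD /=; congr EFin; exact: pdfE.
have iD : mu.-integrable D (EFin \o (fun s => expR (- c * s))).
  have : mu.-integrable D (fun s => c^-1%:E * (EFin \o (fun s => (c * expR (- c * s))%R)) s)%E.
    by apply: integrableZl.
  apply: eq_integrable => // s _ /=; rewrite -EFinM mulrA mulVf ?mul1r//.
  by rewrite gt_eqF.
split => //.
have : \int[mu]_(s in D) (c * expR (- c * s)) = 1.
  rewrite (_ : 1 = fine (\int[mu]_x (exponential_pdf c x)%:E)); last first.
    by rewrite integral_exponential_pdf.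
  rewrite /exponential_pdf -/(Rintegral mu setT _).
  by rewrite -Rintegral_mkcond.
rewrite RintegralZl// => h; apply: (@mulfI _ c); first by rewrite gt_eqF.
by rewrite h mulfV// gt_eqF.
Qed.

Section one_function.
Variables (a M : R) (phi : R -> R).
Hypothesis gphi : exp_growth a M phi.

Lemma growth_ge0 : 0 <= M.
Proof.
have := growth_le gphi (lexx 0).
by rewrite mulr0 expR0 mulr1; apply: le_trans.
Qed.

Lemma laplace_integrand_le b s : 0 <= s ->
  `|expR (- (b * s)) * phi s| <= M * expR (- (b - a) * s).
Proof.
move=> s0; rewrite normrM ger0_norm ?expR_ge0//.
rewrite (le_trans (ler_wpM2l (expR_ge0 _) (growth_le gphi s0)))//.
by rewrite mulrCA -expRD; rewrite (_ : - (b * s) + a * s = - (b - a) * s)//; ring.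
Qed.

Lemma measurable_laplace b : measurable_fun D (fun s => expR (- (b * s)) * phi s).
Proof.
apply: measurable_funM; last exact: growth_meas gphi.
rewrite (_ : (fun s => _) = (fun s => expR (- b * s))).
  exact: measurable_expRM.
by apply/funext => s; rewrite mulNr.
Qed.

Lemma integrable_dom b : a < b ->
  mu.-integrable D (EFin \o (fun s => M * expR (- (b - a) * s))).
Proof.
move=> ab; have [i _] := @integral_expRN (b - a) (ltac:(by rewrite subr_gt0)).
exact: (integrableZl _ M i).
Qed.

Lemma integrable_laplace b : a < b ->
  mu.-integrable D (EFin \o (fun s => expR (- (b * s)) * phi s)).
Proof.
move=> ab; apply: (integrable_dominated _ _ (integrable_dom ab)) => //.
  exact: measurable_laplace.
by move=> s /in_halfline; exact: laplace_integrand_le.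
Qed.

Lemma laplace_le b : a < b -> `|laplace b phi| <= M / (b - a).
Proof.
move=> ab; rewrite /laplace.
rewrite (le_trans (le_normr_Rintegral _ (integrable_laplace ab)))//.
have ba : 0 < b - a by rewrite subr_gt0.
have [i <-] := integral_expRN ba.
rewrite -RintegralZl//; apply: le_Rintegral => //.
- apply: (integrable_dominated _ _ (integrable_dom ab)) => //.
    by apply: measurableT_comp => //; exact: measurable_laplace.
  by move=> s /in_halfline s0; rewrite normr_id; exact: laplace_integrand_le.
- exact: integrable_dom.
- by move=> s /in_halfline; exact: laplace_integrand_le.
Qed.

End one_function.

Lemma exp_growthB a M1 M2 phi psi : exp_growth a M1 phi ->
  exp_growth a M2 psi -> exp_growth a (M1 + M2) (fun s => phi s - psi s).
Proof.
move=> g1 g2; split.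
  by apply: measurable_funB; [exact: growth_meas g1|exact: growth_meas g2].
move=> s s0; rewrite mulrDl (le_trans (ler_normB _ _))// lerD//.
  exact: (growth_le g1).
exact: (growth_le g2).
Qed.

Lemma laplaceB a M1 M2 phi psi b : exp_growth a M1 phi ->
  exp_growth a M2 psi -> a < b ->
  laplace b (fun s => phi s - psi s) = laplace b phi - laplace b psi.
Proof.
move=> g1 g2 ab; rewrite /laplace -RintegralB//; last 2 first.
- exact: (integrable_laplace g1).
- exact: (integrable_laplace g2).
by apply: eq_Rintegral => s _; rewrite mulrBr.
Qed.

Lemma eq_laplace b phi psi : (forall s, 0 <= s -> phi s = psi s) ->
  laplace b phi = laplace b psi.
Proof.
by move=> e; apply: eq_Rintegral => s /set_mem/in_halfline s0; rewrite e.
Qed.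

Lemma laplace_cst b c : 0 < b -> laplace b (fun=> c) = c / b.
Proof.
move=> b0; have [i <-] := integral_expRN b0.
rewrite -RintegralZl//; apply: eq_Rintegral => s _.
by rewrite mulNr mulrC.
Qed.

Lemma exp_growth_cst a c : 0 <= a -> exp_growth a `|c| (fun=> c).
Proof.
move=> a0; split; first exact: measurable_cst.
by move=> s s0; rewrite ler_peMr// -expR0 ler_expR mulr_ge0.
Qed.

(** Abel's theorem in a quantitative form. The modulus of continuity of phi at
    0 is encoded by a difference of two exponentials, because its Laplace
    transform is explicit: with it, L_b integrates the hypothesis to
    eps / b + K (1 / (b - a - 1) - 1 / (b - a)), and multiplication by b leaves
    eps + O(K / b). Only eps and K enter the bound, hence the uniformity in the
    set A when phi s = (T_(s + t) u, 1_A). *)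
Lemma abel_bound a M phi c eps K b : exp_growth a M phi ->
  0 <= a -> 0 <= K -> 0 <= eps ->
  (forall s, 0 <= s -> `|phi s - c| <= eps + K * (expR ((a + 1) * s) - expR (a * s))) ->
  2 * (a + 1) <= b -> `|b * laplace b phi - c| <= eps + 4 * K / b.
Proof.
move=> g a0 K0 eps0 hphi hb.
have b0 : 0 < b by lra.
have ab : a < b by lra.
have g' := exp_growthB g (exp_growth_cst c a0).
have -> : b * laplace b phi - c = b * laplace b (fun s => phi s - c).
  rewrite (laplaceB g (exp_growth_cst c a0) ab) laplace_cst// mulrBr.
  by rewrite mulrCA mulfV ?mulr1// gt_eqF.
rewrite normrM gtr0_norm//.
have [i0 e0] := integral_expRN b0.
have ba1 : 0 < b - (a + 1) by lra.
have ba : 0 < b - a by lra.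
have [i1 e1] := integral_expRN ba1.
have [i2 e2] := integral_expRN ba.
have iB : mu.-integrable D (EFin \o (fun s => eps * expR (- b * s) +
    K * (expR (- (b - (a + 1)) * s) - expR (- (b - a) * s)))).
  apply: integrable_EFinD => //; first exact: integrable_EFinZ.
  by apply: integrable_EFinZ => //; exact: integrable_EFinB.
have : `|laplace b (fun s => phi s - c)| <=
    eps * b^-1 + K * ((b - (a + 1))^-1 - (b - a)^-1).
  rewrite (le_trans (le_normr_Rintegral _ (integrable_laplace g' ab)))//.
  rewrite -e0 -e1 -e2 -RintegralB// -RintegralZl// -RintegralZl//; last first.
    exact: (integrableB _ i1 i2).
  rewrite -RintegralD//; last 2 first.
    exact: (integrableZl _ eps i0).
    by apply: integrable_EFinZ => //; exact: integrable_EFinB.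
  apply: le_Rintegral => //.
    have := integrable_norm (integrable_laplace g' ab); apply: eq_integrable => //.
  move=> s /in_halfline s0; rewrite normrM ger0_norm ?expR_ge0//.
  rewrite (le_trans (ler_wpM2l (expR_ge0 _) (hphi s s0)))//.
  rewrite mulrDr mulNr mulrC lerD2l mulrCA mulrBr -!expRD.
  rewrite (_ : - (b * s) + (a + 1) * s = - (b - (a + 1)) * s); last by ring.
  by rewrite (_ : - (b * s) + a * s = - (b - a) * s); last by ring.
move=> /(ler_wpM2l (ltW b0)) /le_trans; apply.
rewrite mulrDr (_ : b * (eps * b^-1) = eps); last by field; rewrite gt_eqF.
rewrite lerD2l.
have -> : b * (K * ((b - (a + 1))^-1 - (b - a)^-1)) =
    K * (b / ((b - (a + 1)) * (b - a))).
  by field; rewrite !gt_eqF.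
rewrite [leRHS](_ : _ = K * (4 / b)); last by ring.
rewrite ler_wpM2l// ler_pdivrMr ?mulr_gt0// mulrAC ler_pdivlMr//.
nra.
Qed.

(** Brings a function that is small near 0 and of exponential growth into the
    form required by Abel's theorem: near 0 the term eps suffices, and beyond d
    the difference of exponentials is at least d exp (a s). *)
Lemma growth_modulus a M (psi : R -> R) eps : 0 <= a -> 0 <= M ->
  0 < eps -> (forall s, 0 <= s -> psi s <= M * expR (a * s)) ->
  (forall e, 0 < e -> exists2 d, 0 < d & forall s, 0 <= s -> s < d -> psi s <= e) ->
  exists2 K, 0 <= K & forall s, 0 <= s ->
    psi s <= eps + K * (expR ((a + 1) * s) - expR (a * s)).
Proof.
move=> a0 M0 eps0 hM h0; have [d d0 hd] := h0 _ eps0.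
exists (M / d); first by rewrite divr_ge0// ltW.
move=> s s0.
have E : expR ((a + 1) * s) - expR (a * s) = expR (a * s) * (expR s - 1).
  by rewrite mulrDl mul1r expRD; ring.
have es : s <= expR s - 1 by have := expR_ge1Dx s; lra.
have [sd|ds] := ltP s d.
  rewrite (le_trans (hd _ s0 sd))// lerDl E !mulr_ge0// ?expR_ge0//.
    by rewrite invr_ge0 ltW.
  lra.
rewrite (le_trans (hM _ s0))//.
rewrite (@le_trans _ _ (M / d * (expR ((a + 1) * s) - expR (a * s))))//; last first.
  by rewrite lerDr ltW.
rewrite E [leRHS](_ : _ = M * expR (a * s) * ((expR s - 1) / d)); last by ring.
rewrite ler_peMr ?mulr_ge0 ?expR_ge0// ler_pdivlMr// mul1r.
by rewrite (le_trans ds).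
Qed.

(** * Phragmen's inversion formula *)

Lemma lebesgue_measure_shift (t : R) (A : set R) : measurable A ->
  pushforward mu (fun s : R => s + t : measurableTypeR R) A = mu A.
Proof.
move=> mA; apply/esym/lebesgue_measure_unique => //=.
  exact: measurable_funD.
move=> _ _ [[x y] _ <-].
rewrite /pushforward (_ : _ @^-1` `]x, y]%classic = `]x - t, y - t]%classic).
  rewrite !lebesgue_measure_itv/= !lte_fin ltrBlDr subrK.
  by case: ifP => // _; rewrite -!EFinB; congr EFin; ring.
by apply/seteqP; split => s /=; rewrite !in_itv/= ltrBlDr lerBrDr.
Qed.

Lemma Rintegral_shift (f : R -> R) (t : R) :
  measurable_fun (`[t, +oo[%classic : set R) f ->
  mu.-integrable D (EFin \o (fun s => f (s + t))) ->
  \int[mu]_(s in `[t, +oo[) f s = \int[mu]_(s in D) f (s + t).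
Proof.
move=> mf if_.
pose sh : R -> measurableTypeR R := fun s => s + t.
have msh : measurable_fun setT sh by exact: measurable_funD.
have preD : sh @^-1` `[t, +oo[%classic = D.
  by apply/seteqP; split => s /=; rewrite !in_itv/= !andbT /sh lerDr.
have fD : (f \_ `[t, +oo[%classic) \o sh = (fun s => f (s + t)) \_ D.
  by apply/funext => s; rewrite /= !patchE -[in RHS]preD.
rewrite [LHS]Rintegral_mkcond [RHS]Rintegral_mkcond -fD /Rintegral; congr fine.
have E (A : set (measurableTypeR R)) : measurable A -> A `<=` setT -> mu A = pushforward mu sh A.
  by move=> mA _; rewrite lebesgue_measure_shift.
rewrite (eq_measure_integral _ E).
rewrite integral_pushforward//.
- apply/measurable_EFinP; apply/(measurable_restrict f) => //.
  by rewrite setTI.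
- rewrite preimage_setT -/sh.
  rewrite (_ : _ \o _ = EFin \o ((f \_ `[t, +oo[%classic) \o sh))// fD.
  rewrite -restrict_EFin; by apply: (integrable_mkcond _ _).1.
Qed.

(** Partial sums of Phragmen's inversion formula. With x = exp (n t), the
    factor (- x) ^ k / k! weighs L_(b + k n) phi = L_b (exp (- k n .) phi);
    summing over k produces the kernel exp (- exp (n (t - s))), which tends to
    the indicator of s > t as n tends to infinity. *)
Definition phragmen_sum b t phi (n N : nat) : R :=
  \sum_(0 <= k < N) exp_coeff (- expR (n%:R * t)) k * laplace (b + (k * n)%:R) phi.

Lemma exp_growthM a M phi c (k : R -> R) : exp_growth a M phi ->
  measurable_fun D k -> (forall s, 0 <= s -> `|k s| <= c) ->
  exp_growth a (c * M) (fun s => k s * phi s).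
Proof.
move=> g mk kc; split; first exact: measurable_funM mk (growth_meas g).
move=> s s0; rewrite normrM -mulrA ler_pM// ?kc//; exact: (growth_le g).
Qed.

Lemma laplaceD a M1 M2 phi psi b : exp_growth a M1 phi ->
  exp_growth a M2 psi -> a < b ->
  laplace b (fun s => phi s + psi s) = laplace b phi + laplace b psi.
Proof.
move=> g1 g2 ab; rewrite /laplace -RintegralD//; last 2 first.
- exact: (integrable_laplace g1).
- exact: (integrable_laplace g2).
by apply: eq_Rintegral => s _; rewrite mulrDr.
Qed.

Lemma laplaceZ a M phi b c : exp_growth a M phi -> a < b ->
  laplace b (fun s => c * phi s) = c * laplace b phi.
Proof.
move=> g ab; rewrite /laplace -RintegralZl//; last exact: (integrable_laplace g).
by apply: eq_Rintegral => s _; rewrite mulrCA.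
Qed.

Lemma laplace_cvg a M (phi_ : nat -> R -> R) phi b :
  (forall n, exp_growth a M (phi_ n)) -> a < b ->
  (forall s, 0 <= s -> phi_ n s @[n --> \oo] --> phi s) ->
  laplace b (phi_ n) @[n --> \oo] --> laplace b phi.
Proof.
move=> g ab cv; have idom := integrable_dom M ab.
apply: (Rintegral_dominated_cvg _ _ _ idom) => //.
- by move=> n; exact: measurable_laplace (g n) b.
- by move=> s /in_halfline s0; apply: cvgMr; exact: cv.
- by move=> n s /in_halfline s0; exact: (laplace_integrand_le (g n)).
Qed.

Lemma series_exp_coeff_bound (x : R) N : `|series (exp_coeff (- x)) N| <= expR `|x|.
Proof.
apply: (@le_trans _ _ (series (exp_coeff `|x|) N)).
  rewrite /series /= (le_trans (ler_norm_sum _ _ _))//.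
  by apply: ler_sum => k _; rewrite /exp_coeff /= normrM normrX normrN [`|_^-1|]ger0_norm ?invr_ge0.
apply: nondecreasing_cvgn_le; last exact: is_cvg_series_exp_coeff.
apply/nondecreasing_seqP => n; rewrite /series /= big_nat_recr//= lerDl.
exact: exp_coeff_ge0.
Qed.

(** A right-continuous function is the limit of its values at the endpoints
    s < g n s <= s + 1 / (n + 1) of a grid, and phi o g n is constant on each of
    countably many intervals. *)
Lemma right_continuous_measurable phi :
  (forall s, 0 <= s -> phi r @[r --> s^'+] --> phi s) -> measurable_fun D phi.
Proof.
move=> rc.
pose g n (s : R) := (Num.floor (n.+1%:R * s) + 1)%:~R / n.+1%:R : R.
have mfl n : measurable_fun D (fun s => phi (g n s)).
  move=> mD B mB.
  pose S := [set k : int | B (phi ((k + 1)%:~R / n.+1%:R))].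
  rewrite [X in measurable X](_ : _ = \bigcup_(k in S)
      (D `&` `[(k%:~R / n.+1%:R : R), ((k + 1)%:~R / n.+1%:R)[%classic)).
    rewrite bigcup_mkcond; apply: countable_bigcupT_measurable => [|k].
      exact: countableP.
    by case: ifP => // _; apply: measurableI.
  apply/seteqP; split => s.
    move=> [Ds Bs]; exists (Num.floor (n.+1%:R * s)) => //; split => //=.
    rewrite in_itv/=; apply/andP; split.
      by rewrite ler_pdivrMr// mulrC floor_le.
    by rewrite ltr_pdivlMr// mulrC floorD1_gt.
  move=> [k Sk [Ds]] /=; rewrite in_itv/= => /andP[h1 h2]; split => //.
  rewrite /g (_ : Num.floor _ = k)//; apply/floor_def.
  by rewrite mulrC -ler_pdivrMr// h1 -ltr_pdivlMr.
apply: (measurable_fun_cvg mfl) => s /in_halfline s0.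
have gs n : s < g n s <= s + n.+1%:R^-1.
  rewrite /g ltr_pdivlMr// mulrC floorD1_gt/= ler_pdivrMr// mulrDl mulVf ?pnatr_eq0//.
  by rewrite intrD lerD2r mulrC floor_le.
have := rc s s0; move/cvg_at_rightP; apply; split => [n|].
  by have /andP[] := gs n.
apply: (@squeeze_cvgr _ _ _ _ (fun=> s) (fun n => s + n.+1%:R^-1)).
- by apply: nearW => n; have /andP[/ltW -> ->] := gs n.
- exact: cvg_cst.
- rewrite -[X in _ --> X]addr0; apply: cvgD; first exact: cvg_cst.
  exact: cvg_harmonic.
Qed.

(** The sum is the Laplace transform of phi times a partial sum of the
    exponential series at - exp (n (t - s)). For s >= 0 these partial sums are
    bounded by exp (exp (n t)), whatever their number of terms: this makes the
    limit in N dominated. *)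
Lemma phragmen_sumE a M phi b t n N : exp_growth a M phi -> 0 <= t -> a < b ->
  exp_growth a (expR (expR (n%:R * t)) * M)
    (fun s => series (exp_coeff (- expR (n%:R * (t - s)))) N * phi s) /\
  phragmen_sum b t phi n N =
  laplace b (fun s => series (exp_coeff (- expR (n%:R * (t - s)))) N * phi s).
Proof.
move=> g t0 ab.
have cE k : (fun s : R => exp_coeff (- expR (n%:R * (t - s))) k) =
    (fun s => exp_coeff (- expR (n%:R * t)) k * expR (- ((k * n)%:R * s))).
  apply/funext => s; rewrite /exp_coeff /=.
  rewrite (_ : - expR _ = - expR (n%:R * t) * expR (- (n%:R * s))); last first.
    by rewrite mulrBr expRD mulNr.
  rewrite exprMn -!mulrA.
  congr (_ * _); rewrite mulrC; congr (_ * _).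
  by rewrite -expRM_natl; congr expR; rewrite natrM; ring.
have mk k : measurable_fun D (fun s : R => expR (- ((k * n)%:R * s))).
  rewrite (_ : (fun s : R => _) = fun s => expR (- (k * n)%:R * s)).
    exact: measurable_expRM.
  by apply/funext => s; rewrite mulNr.
have mS N' : measurable_fun D
    (fun s : R => series (exp_coeff (- expR (n%:R * (t - s)))) N').
  elim: N' => [|N' IH].
    rewrite (_ : (fun s => _) = cst 0); first exact: measurable_cst.
    by apply/funext => s; rewrite /series /= big_geq.
  rewrite (_ : (fun s : R => series _ N'.+1) = (fun s =>
      series (exp_coeff (- expR (n%:R * (t - s)))) N' +
      exp_coeff (- expR (n%:R * (t - s))) N')).
    by apply: measurable_funD => //; rewrite cE; exact: measurable_funM.
  by apply/funext => s; rewrite /series /= big_nat_recr.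
have gS N' : exp_growth a (expR (expR (n%:R * t)) * M)
    (fun s => series (exp_coeff (- expR (n%:R * (t - s)))) N' * phi s).
  apply: exp_growthM g (mS N') _ => s s0.
  rewrite (le_trans (series_exp_coeff_bound _ _))//.
  rewrite ger0_norm ?expR_ge0// !ler_expR ler_wpM2l//; lra.
split; first exact: gS.
elim: N => [|N IH].
  rewrite /phragmen_sum big_nil /laplace (_ : (fun s => _) = cst 0).
    by rewrite Rintegral_cst//= mul0r.
  by apply/funext => s; rewrite /series /= big_nil mul0r mulr0.
rewrite /phragmen_sum big_nat_recr//= -/(phragmen_sum _ _ _ _ _) IH.
set c := exp_coeff _ _.
have gk : exp_growth a (1 * M) (fun s => expR (- ((N * n)%:R * s)) * phi s).
  apply: exp_growthM g (mk N) _ => s s0.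
  by rewrite ger0_norm ?expR_ge0// -expR0 ler_expR oppr_le0 mulr_ge0.
have gck : exp_growth a (`|c| * (1 * M)) (fun s => c * (expR (- ((N * n)%:R * s)) * phi s)).
  by apply: exp_growthM gk _ _.
have -> : laplace (b + (N * n)%:R) phi = laplace b (fun s => expR (- ((N * n)%:R * s)) * phi s).
  rewrite /laplace; apply: eq_Rintegral => s _.
  by rewrite mulrA -expRD mulrDl opprD.
rewrite -(laplaceZ c gk ab) -(laplaceD (gS N) gck ab).
apply: eq_Rintegral => s _; congr (_ * _).
rewrite /series /= big_nat_recr//= mulrDl; congr (_ + _).
by have /(congr1 (@^~ s)) -> := cE N; rewrite mulrA.
Qed.

Lemma exp_growth_shift a M phi t : exp_growth a M phi -> 0 <= t ->
  exp_growth a (M * expR (a * t)) (fun s => phi (s + t)).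
Proof.
move=> g t0; split.
  apply: (@measurable_comp _ _ _ _ _ _ D phi D (fun s => s + t)) => //.
  - by move=> _ [s /in_halfline s0 <-]; apply/in_halfline; rewrite addr_ge0.
  - exact: growth_meas g.
  - exact: measurable_funD.
move=> s s0; rewrite (le_trans (growth_le g (addr_ge0 s0 t0)))//.
by rewrite mulrDr expRD [leRHS]mulrAC -mulrA.
Qed.

Definition phragmen_lim b t phi (n : nat) : R :=
  laplace b (fun s => expR (- expR (n%:R * (t - s))) * phi s).

(** The two successive limits, over the number N of terms and then over n, with
    bounds that depend on phi only through its growth constant M. Such uniform
    bounds allow both limits to be taken under an integral over a parameter on
    which phi depends. *)
Lemma phragmen_cvg a M phi b t : exp_growth a M phi -> 0 <= t -> a < b ->
  [/\ forall n, phragmen_sum b t phi n N @[N --> \oo] --> phragmen_lim b t phi n,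
      forall n N, `|phragmen_sum b t phi n N| <= expR (expR (n%:R * t)) * M / (b - a),
      forall n, `|phragmen_lim b t phi n| <= M / (b - a) &
      phragmen_lim b t phi n @[n --> \oo] --> expR (- (b * t)) * laplace b (fun s => phi (s + t))].
Proof.
move=> g t0 ab.
pose K n s : R := expR (- expR (n%:R * (t - s))).
have mK n : measurable_fun D (K n).
  apply: measurable_funTS; apply: continuous_measurable_fun => s.
  apply: continuous_comp; last exact: continuous_expR.
  apply: continuousN; apply: continuous_comp; last exact: continuous_expR.
  apply: continuousM; first exact: cst_continuous.
  by apply: continuousB; [exact: cst_continuous|exact: cvg_id].
have K1 n s : `|K n s| <= 1.
  by rewrite ger0_norm ?expR_ge0// /K -expR0 ler_expR oppr_le0 expR_ge0.
have gK n : exp_growth a (1 * M) (fun s => K n s * phi s).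
  by apply: exp_growthM g (mK n) _ => s _; exact: K1.
split.
- move=> n.
  have [_ E0] := phragmen_sumE n 0%N g t0 ab.
  rewrite (_ : (fun N => _) = fun N => laplace b
    (fun s => series (exp_coeff (- expR (n%:R * (t - s)))) N * phi s)); last first.
    by apply/funext => N; have [_ ->] := phragmen_sumE n N g t0 ab.
  apply: (laplace_cvg _ ab) => [N|s s0].
    by have [h _] := phragmen_sumE n N g t0 ab; exact: h.
  by apply: cvgMl; exact: is_cvg_series_exp_coeff.
- by move=> n N; have [h ->] := phragmen_sumE n N g t0 ab; exact: (laplace_le h ab).
- by move=> n; have := laplace_le (gK n) ab; rewrite mul1r.
(* Value of the limit kernel: the point s = t gives exp (- 1), and is a null
   set. *)
pose J s : R := if s < t then 0 else if s == t then expR (- 1) else 1.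
have KJ s : K n s @[n --> \oo] --> J s.
  rewrite /K /J; case: ltgtP => st.
  - apply: (@cvg_comp _ _ _ (fun n : nat => expR (n%:R * (t - s)))
      (fun x => expR (- x)) _ (pinfty_nbhs R)); last exact: cvgr_expR.
    apply/cvgryPge => A; near=> n.
    have : n%:R * (t - s) <= expR (n%:R * (t - s)).
      by have := expR_ge1Dx (n%:R * (t - s)); lra.
    apply: le_trans; rewrite -ler_pdivrMr ?subr_gt0//.
    by near: n; exact: nbhs_infty_ger.
  - suff /cvg_comp/(_ (@continuous_expR R 0)) : - expR (n%:R * (t - s)) @[n --> \oo] --> (0 : R).
      by rewrite expR0.
    rewrite -oppr0; apply: cvgN.
    have -> : (fun n : nat => expR (n%:R * (t - s))) = (fun n => expR (- (n%:R * (s - t)))).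
      by apply/funext => n; congr expR; ring.
    apply: (@cvg_comp _ _ _ (fun n : nat => n%:R * (s - t))
      (fun x => expR (- x)) _ (pinfty_nbhs R)); last exact: cvgr_expR.
    apply/cvgryPge => A; near=> n; rewrite -ler_pdivrMr ?subr_gt0//.
    by near: n; exact: nbhs_infty_ger.
  - by rewrite st subrr; under eq_fun do rewrite mulr0 expR0; exact: cvg_cst.
have := @laplace_cvg a (1 * M) (fun n s => K n s * phi s) (fun s => J s * phi s) b gK ab.
have KJphi s : 0 <= s -> K n s * phi s @[n --> \oo] --> J s * phi s.
  by move=> _; apply: cvgMl; exact: KJ.
move=> /(_ KJphi).
suff -> : laplace b (fun s => J s * phi s) = expR (- (b * t)) * laplace b (fun s => phi (s + t)) by [].
have mJ : measurable_fun D J by apply: (measurable_fun_cvg mK) => s _; exact: KJ.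
have gt := exp_growth_shift g t0.
pose h s := expR (- (b * s)) * phi s.
have mh : measurable_fun D h by exact: measurable_laplace g b.
have tD : (`[t, +oo[%classic : set R) `<=` D.
  by move=> s /=; rewrite !in_itv/= !andbT; exact: le_trans.
have mht : measurable_fun (`[t, +oo[%classic : set R) h.
  by apply: measurable_funS mh.
transitivity (\int[mu]_(s in D) (h \_ `[t, +oo[%classic) s).
  rewrite /laplace /Rintegral; congr fine; apply: ae_eq_integral => //.
  - apply/measurable_EFinP.
    rewrite (_ : (fun s => _) = (fun s => J s * h s)).
      exact: measurable_funM.
    by apply/funext => s; rewrite /h mulrCA.
  - apply/measurable_EFinP; apply/(measurable_restrict h) => //.
    by apply: measurable_funS mh => //; exact: subIset.
  exists [set t]; split; [exact: measurable_set1|exact: lebesgue_measure_set1|].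
  move=> s /= /existsNP[Ds hs]; apply: contrapT => st; apply: hs; congr EFin.
  rewrite patchE /J; case: ltgtP st => // st _.
    by rewrite mul0r mulr0 ifF//; apply/negP => /set_mem /=; rewrite in_itv/= andbT leNgt st.
  by rewrite mul1r ifT//; apply/mem_set; rewrite /= in_itv/= ltW.
have hE : (fun s => h (s + t)) =
    (fun s => expR (- (b * t)) * (expR (- (b * s)) * phi (s + t))).
  by apply/funext => s; rewrite /h mulrA -expRD; congr (expR _ * _); ring.
have igt := integrable_laplace gt ab.
rewrite -Rintegral_mkcondr setIidr// Rintegral_shift// hE ?RintegralZl//.
exact: integrable_EFinZ.
Unshelve. all: by end_near. Qed.

Lemma abel_cvg a M phi e : exp_growth a M phi -> 0 <= a -> 0 < e ->
  phi r @[r --> 0^'+] --> phi 0 ->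
  exists B, forall b, B <= b -> `|b * laplace b phi - phi 0| <= e.
Proof.
move=> g a0 e0 c0.
have M0 := growth_ge0 g.
have e20 : 0 < e / 2 by rewrite divr_gt0.
have [||d d0|K K0 hK] := @growth_modulus a (M + M) (fun s => `|phi s - phi 0|) (e / 2) a0 _ e20.
- exact: addr_ge0.
- move=> s s0; rewrite (le_trans (ler_normB _ _))// mulrDl lerD ?(growth_le g s0)//.
  rewrite (le_trans (growth_le g (lexx 0)))// mulr0 expR0 ler_wpM2l//.
  by rewrite -expR0 ler_expR mulr_ge0.
- move: c0 => /cvgrPdist_le /(_ d d0); rewrite near_withinE => -[r /= r0 hr].
  exists r => // s; rewrite le_eqVlt => /predU1P[<- _|s0 sr]; first by rewrite subrr normr0 ltW.
  by rewrite distrC; apply: hr => //; rewrite /ball_ /= sub0r normrN ger0_norm// ltW.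
exists (2 * (a + 1) + 8 * K / e) => b hb.
have Ke : 0 <= 8 * K / e by rewrite divr_ge0 ?mulr_ge0// ltW.
have b0 : 0 < b by apply: lt_le_trans hb; rewrite ltr_wpDr// mulr_gt0// ltr_wpDl.
rewrite (le_trans (abel_bound g a0 K0 (ltW e20) hK _))//; first by apply: le_trans hb; rewrite lerDl.
rewrite [leRHS]splitr lerD2l ler_pdivrMr//.
have : 8 * K / e <= b by apply: le_trans hb; rewrite lerDr mulr_ge0// addr_ge0.
by rewrite ler_pdivrMr//; lra.
Qed.

End laplace.

Section laplace_tail.
Context d (T : measurableType d) (R : realType) (mu : {measure set T -> \bar R}).

Lemma integrable_bounded (A : set T) (f : T -> R) C : measurable A -> (mu A < +oo)%E ->
  measurable_fun A f -> (forall x, `|f x| <= C) -> mu.-integrable A (EFin \o f).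
Proof.
move=> mA fA mf fC.
have iC : mu.-integrable A (EFin \o cst C).
  apply/integrableP; split; first exact/measurable_EFinP.
  by rewrite /= integral_cst//= lte_mul_pinfty.
exact: (integrable_dominated mA mf iC).
Qed.

(** If psi is the integral of the family phi in the sense of Laplace transforms
    at large arguments, so is the shifted psi for the shifted family: by
    Phragmen's formula, the transforms of the shifted functions are limits of
    finite linear combinations of the transforms of the functions themselves.
    This takes the place of Fubini's theorem, for which (x, s) |-> phi x s would
    have to be jointly measurable and psi s to be the integral of phi x s at
    every s. *)
Lemma laplace_tail_integral (A : set T) (phi : T -> R -> R) (psi : R -> R) a b M M' t :
  measurable A -> (mu A < +oo)%E -> 0 <= t -> a < b ->
  (forall x, exp_growth a M (phi x)) -> exp_growth a M' psi ->
  (forall c, b <= c -> measurable_fun setT (fun x => laplace c (phi x))) ->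
  (forall c, b <= c -> \int[mu]_(x in A) laplace c (phi x) = laplace c psi) ->
  \int[mu]_(x in A) laplace b (fun s => phi x (s + t)) =
  laplace b (fun s => psi (s + t)).
Proof.
move=> mA fA t0 ab gphi gpsi mL iL.
have bk k : b <= b + k%:R by rewrite lerDl.
have abk k : a < b + k%:R := lt_le_trans ab (bk k).
pose S n N x := phragmen_sum b t (phi x) n N.
have mS n N : measurable_fun A (S n N).
  apply: measurable_funTS; apply: measurable_sum => k.
  by apply: measurable_funM => //; exact: mL.
have iS n N : \int[mu]_(x in A) S n N x = phragmen_sum b t psi n N.
  rewrite /S /phragmen_sum.
  elim: N => [|N IH].
    rewrite big_nil; under eq_Rintegral do rewrite big_nil.
    by rewrite Rintegral_cst// mul0r.
  rewrite big_nat_recr//= -IH -iL// -RintegralZl//; last first.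
    apply: (integrable_bounded mA fA (C := M / (b + (N * n)%:R - a))).
      by apply: measurable_funTS; exact: mL.
    by move=> x; exact: (laplace_le (gphi x)).
  rewrite -RintegralD//; last 2 first.
  - have [h1 h2 _ _] := phragmen_cvg gpsi t0 ab.
    apply: (integrable_bounded mA fA (C := expR (expR (n%:R * t)) * M / (b - a))).
      exact: mS.
    by move=> x; have [_ h _ _] := phragmen_cvg (gphi x) t0 ab; exact: h.
  - apply: integrable_EFinZ => //.
    apply: (integrable_bounded mA fA (C := M / (b + (N * n)%:R - a))).
      by apply: measurable_funTS; exact: mL.
    by move=> x; exact: (laplace_le (gphi x)).
  by apply: eq_Rintegral => x _; rewrite big_nat_recr.
pose W n x := phragmen_lim b t (phi x) n.
have SW n x : S n N x @[N --> \oo] --> W n x.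
  by have [h _ _ _] := phragmen_cvg (gphi x) t0 ab; exact: h.
have mW n : measurable_fun A (W n) by apply: (measurable_fun_cvg (mS n)) => x _; exact: SW.
have icst C : mu.-integrable A (EFin \o cst C).
  by apply: (integrable_bounded mA fA (C := `|C|)) => //; exact: measurable_cst.
have iW n : \int[mu]_(x in A) W n x = phragmen_lim b t psi n.
  have [h _ _ _] := phragmen_cvg gpsi t0 ab.
  rewrite -(cvg_lim _ (h n))//; apply/esym/cvg_lim => //.
  under eq_fun do rewrite -iS.
  apply: (Rintegral_dominated_cvg mA (mS n) _ (icst (expR (expR (n%:R * t)) * M / (b - a)))) => [x _|N x _].
    exact: SW.
  by have [_ h' _ _] := phragmen_cvg (gphi x) t0 ab; exact: h'.
have [_ _ _ h] := phragmen_cvg gpsi t0 ab.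
have e0 : expR (- (b * t)) != 0 by rewrite gt_eqF ?expR_gt0.
apply: (mulfI e0); rewrite -(cvg_lim _ h)//; apply/esym/cvg_lim => //.
under eq_fun do rewrite -iW.
have WL x : W n x @[n --> \oo] --> expR (- (b * t)) * laplace b (fun s => phi x (s + t)).
  by have [_ _ _ h'] := phragmen_cvg (gphi x) t0 ab; exact: h'.
rewrite -RintegralZl//; last first.
  apply: (integrable_bounded mA fA (C := M * expR (a * t) / (b - a))).
    rewrite (_ : (fun x => _) = (fun x => (expR (- (b * t)))^-1 *
        (expR (- (b * t)) * laplace b (fun s => phi x (s + t))))).
      apply: measurable_funM => //.
      by apply: (measurable_fun_cvg mW) => x _; exact: WL.
    by apply/funext => x; rewrite mulKf.
  by move=> x; exact: (laplace_le (exp_growth_shift (gphi x) t0)).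
apply: (Rintegral_dominated_cvg mA mW _ (icst (M / (b - a)))) => [x _|n x _].
  exact: WL.
by have [_ _ h' _] := phragmen_cvg (gphi x) t0 ab; exact: h'.
Qed.

End laplace_tail.

(** * The space L2 of square-integrable functions *)
Section square_integrable.
Context {R : realType} {E : pmetricType R}.
Variable m : {measure set (borel E) -> \bar R}.
Implicit Types (u v w : E -> R) (a c : R).

Definition sqint u : Prop := (u : borel E -> R) \in Lfun m 2%:E.
Definition nrm2 u : R := Num.sqrt (ip m u u).

Lemma sqintP u : sqint u <-> measurable_fun [set: borel E] (u : borel E -> R) /\
  m.-integrable setT (EFin \o (fun x : borel E => u x ^+ 2)).
Proof.
split=> [Lu|[mu iu]].
  split; last exact: Lfun2_integrable_sqr.
  by move: Lu; rewrite /sqint inE => /andP[/[!inE]].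
rewrite /sqint inE; apply/andP; split; rewrite inE//=.
rewrite /finite_norm unlock poweR_lty//.
move/integrableP : iu => [_]; apply: le_lt_trans.
rewrite le_eqVlt; apply/orP; left; apply/eqP; apply: eq_integral => x _ /=.
by rewrite powR_mulrn// normrX.
Qed.

Lemma sqint_meas u : sqint u -> measurable_fun [set: borel E] (u : borel E -> R).
Proof. by move/sqintP => []. Qed.

Lemma sqint0 : sqint (0 : E -> R).
Proof. by have [] := Lfun_submod_closed m (lee1n 2). Qed.

Lemma sqint_lin a u v : sqint u -> sqint v -> sqint (a *: u + v).
Proof. by have [_] := Lfun_submod_closed m (lee1n 2); apply. Qed.

Lemma sqintD u v : sqint u -> sqint v -> sqint (u + v).
Proof. by move=> Lu Lv; rewrite -(scale1r u); exact: sqint_lin. Qed.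

Lemma sqintZ a u : sqint u -> sqint (a *: u).
Proof. by move=> Lu; rewrite -(addr0 (a *: u)); exact/sqint_lin/sqint0. Qed.

Lemma sqintB u v : sqint u -> sqint v -> sqint (u - v).
Proof. by move=> Lu Lv; rewrite addrC -scaleN1r; exact: sqint_lin. Qed.

Lemma sqint_le u v : measurable_fun [set: borel E] (u : borel E -> R) ->
  sqint v -> (forall x, `|u x| <= `|v x|) -> sqint u.
Proof.
move=> mu /sqintP[mv iv] uv; apply/sqintP; split => //.
apply: (integrable_dominated _ _ iv) => //; first exact: measurable_funX.
by move=> x _; rewrite normrX -[leRHS]real_normK ?num_real// lerXn2r// ?nnegrE.
Qed.

Lemma sqint_mul u v : sqint u -> sqint v ->
  m.-integrable setT (EFin \o (fun x : borel E => u x * v x)).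
Proof. by move=> Lu Lv; apply/Lfun1_integrable/Lfun2_mul_Lfun1. Qed.

Lemma ipC u v : ip m u v = ip m v u.
Proof. by apply: eq_Rintegral => x _; rewrite mulrC. Qed.

Lemma ip_linl a u v w : sqint u -> sqint v -> sqint w ->
  ip m (a *: u + v) w = a * ip m u w + ip m v w.
Proof.
move=> Lu Lv Lw; rewrite /ip -RintegralZl//; last exact: sqint_mul.
rewrite -RintegralD//; [|exact: integrable_EFinZ (sqint_mul _ _)|exact: sqint_mul].
by apply: eq_Rintegral => x _; rewrite !fctE /GRing.scale/= mulrDl mulrA.
Qed.

Lemma ipDl u v w : sqint u -> sqint v -> sqint w ->
  ip m (u + v) w = ip m u w + ip m v w.
Proof. by move=> Lu Lv Lw; have := ip_linl 1 Lu Lv Lw; rewrite scale1r mul1r. Qed.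

Lemma ipZl a u w : sqint u -> sqint w -> ip m (a *: u) w = a * ip m u w.
Proof.
move=> Lu Lw; rewrite /ip -RintegralZl//; last exact: sqint_mul.
by apply: eq_Rintegral => x _; rewrite !fctE /GRing.scale/= mulrA.
Qed.

Lemma ipBl u v w : sqint u -> sqint v -> sqint w ->
  ip m (u - v) w = ip m u w - ip m v w.
Proof.
move=> Lu Lv Lw; rewrite -scaleN1r ipDl ?ipZl ?mulN1r//; exact: sqintZ.
Qed.

Lemma ip_aeql u v w : sqint u -> sqint v -> sqint w -> aeq m u v ->
  ip m u w = ip m v w.
Proof.
move=> Lu Lv Lw uv; rewrite /ip /Rintegral; congr fine.
apply: ae_eq_integral => //.
- exact: measurable_int (sqint_mul Lu Lw).
- exact: measurable_int (sqint_mul Lv Lw).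
- by apply: filterS uv => x /= -> _.
Qed.

Lemma ip_ge0 u : 0 <= ip m u u.
Proof. by apply: Rintegral_ge0 => x _; rewrite -expr2 sqr_ge0. Qed.

Lemma nrm2_ge0 u : 0 <= nrm2 u.
Proof. exact: sqrtr_ge0. Qed.

Lemma sqr_nrm2 u : nrm2 u ^+ 2 = ip m u u.
Proof. by rewrite sqr_sqrtr// ip_ge0. Qed.

Lemma nrm2_aeq u v : sqint u -> sqint v -> aeq m u v -> nrm2 u = nrm2 v.
Proof.
move=> Lu Lv uv; congr Num.sqrt.
by rewrite (ip_aeql Lu Lv Lu uv) ipC (ip_aeql Lu Lv Lv uv).
Qed.

Lemma Lpnorm2E u : sqint u -> Lpnorm m 2%:E u = (nrm2 u)%:E.
Proof.
move=> Lu; rewrite /Lpnorm unlock /nrm2.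
rewrite (_ : (\int[m]_x _)%E = (ip m u u)%:E).
  by rewrite poweR_EFin powR12_sqrt// ip_ge0.
rewrite /ip /Rintegral fineK; last first.
  by apply: integrable_fin_num => //; exact: sqint_mul.
by apply: eq_integral => x _ /=; rewrite powR_mulrn// real_normK ?num_real// expr2.
Qed.

Lemma nrm2Z a u : sqint u -> nrm2 (a *: u) = `|a| * nrm2 u.
Proof.
move=> Lu; rewrite /nrm2 ipZl//; last exact: sqintZ.
rewrite ipC ipZl// mulrA -expr2 sqrtrM ?sqr_ge0// sqrtr_sqr//.
Qed.

Lemma nrm2B u v : nrm2 (u - v) = nrm2 (v - u).
Proof.
congr Num.sqrt; apply: eq_Rintegral => x _.
by rewrite !fctE -mulrNN !opprB.
Qed.

Lemma cauchy_schwarz u v : sqint u -> sqint v ->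
  `|ip m u v| <= nrm2 u * nrm2 v.
Proof.
move=> Lu Lv.
rewrite /ip (le_trans (le_normr_Rintegral _ (sqint_mul Lu Lv)))//.
rewrite -lee_fin EFinM -!Lpnorm2E// /Lpnorm.
apply: le_trans (hoelder _ _ _ _ _ _) => //.
- rewrite Lnorm1 /Rintegral fineK//.
  apply: integrable_fin_num => //.
  by have := integrable_norm (sqint_mul Lu Lv); exact: eq_integrable.
- exact: sqint_meas.
- exact: sqint_meas.
- by rewrite [RHS]splitr !div1r.
Qed.

Lemma nrm2D u v : sqint u -> sqint v -> nrm2 (u + v) <= nrm2 u + nrm2 v.
Proof.
move=> Lu Lv; have Luv := sqintD Lu Lv.
rewrite -ler_sqr ?nnegrE ?nrm2_ge0 ?addr_ge0 ?nrm2_ge0//.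
rewrite sqr_nrm2 ipDl// [ip _ u _]ipC [ip _ v _]ipC !ipDl// [ip _ v u]ipC.
rewrite -!sqr_nrm2 sqrrD.
have := le_trans (ler_norm _) (cauchy_schwarz Lu Lv).
by move=> h; rewrite mulr2n; lra.
Qed.

Lemma sqint_indic (A : set (borel E)) : measurable A -> (m A < +oo)%E ->
  sqint (\1_A : E -> R).
Proof.
move=> mA fA; apply/sqintP; split; first exact: measurable_indic.
apply/integrableP; split.
  by apply/measurable_EFinP; apply: measurable_funX; exact: measurable_indic.
rewrite (_ : (fun x => _) = (fun x => (\1_A x)%:E)).
  by rewrite integral_indic// setIT.
apply/funext => x; rewrite /= indicE; case: (x \in A) => /=.
  by rewrite expr1n normr1.
by rewrite expr0n normr0.
Qed.

Lemma ip_indic u (A : set (borel E)) : measurable A ->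
  ip m u (\1_A : E -> R) = \int[m]_(x in A) (u x).
Proof.
move=> mA; rewrite [RHS]Rintegral_mkcond; apply: eq_Rintegral => x _.
by rewrite patchE indicE; case: ifPn => _; rewrite ?mulr1 ?mulr0.
Qed.

Lemma sqint_integrable u (A : set (borel E)) : measurable A -> (m A < +oo)%E ->
  sqint u -> m.-integrable A (EFin \o (u : borel E -> R)).
Proof.
move=> mA fA Lu; have := sqint_mul Lu (sqint_indic mA fA).
move=> /(integrableS measurableT mA (@subsetT _ _)).
by apply: eq_integrable => // x xA /=; rewrite indicE xA mulr1.
Qed.

Lemma nrm2_dominated_cvg (u_ : nat -> E -> R) u v :
  (forall n, measurable_fun [set: borel E] (u_ n : borel E -> R)) ->
  sqint u -> sqint v ->
  (forall x, u_ n x @[n --> \oo] --> u x) -> (forall n x, `|u_ n x| <= `|v x|) ->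
  nrm2 (u_ n - u) @[n --> \oo] --> (0 : R).
Proof.
move=> mu_ Lu Lv u_u uv.
have ux x : `|u x| <= `|v x|.
  apply: (@cvgn_le _ (fun n => `|u_ n x|)) => [|n]; last exact: uv.
  exact: cvg_norm (u_u x).
rewrite -(sqrtr0 R).
apply: (@cvg_comp _ _ _ (fun n => ip m (u_ n - u) (u_ n - u)) Num.sqrt _ (nbhs (0 : R))); last first.
  exact: sqrt_continuous.
have -> : (0 : R) = \int[m]_(x in [set: borel E]) (0 : R) by rewrite Rintegral_cst// mul0r.
have i4 : m.-integrable [set: borel E] (EFin \o (fun x : borel E => 4 * (v x * v x))).
  exact: integrable_EFinZ (sqint_mul _ _).
apply: (Rintegral_dominated_cvg _ _ _ i4) => //.
- move=> n; apply: measurable_funM; apply: measurable_funB => //; exact: sqint_meas.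
- move=> x _; rewrite -(mulr0 (0 : R)) !fctE.
  by apply: cvgM; rewrite -(subrr (u x)); apply: cvgB => //; exact: cvg_cst.
- move=> n x _; rewrite !fctE normrM -!expr2.
  have : `|u_ n x - u x| <= 2 * `|v x|.
    by rewrite (le_trans (ler_normB _ _))// mulr2n mulrDl mul1r lerD.
  rewrite -(real_normK (num_real (v x))) => h.
  by have : 0 <= `|u_ n x - u x| by []; nra.
Qed.

(** Fatou's lemma, applied to the squares of u_ n - u away from the exceptional
    set, shows that v - u vanishes a.e. It dispenses with extracting an a.e.
    convergent subsequence. *)
Lemma nrm2_cvg_ae_unique (u_ : nat -> E -> R) u v :
  (forall n, sqint (u_ n)) -> sqint u ->
  nrm2 (u_ n - u) @[n --> \oo] --> (0 : R) ->
  {ae m, forall x : borel E, u_ n x @[n --> \oo] --> v x} ->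
  aeq m v u.
Proof.
move=> Lu_ Lu u0 uv.
case: uv => N [mN N0 uvN].
have uvD x : (~` N) x -> u_ n x @[n --> \oo] --> v x.
  by move=> Nx; apply: contrapT => uvx; apply: Nx; exact: uvN.
have mD : measurable (~` N) by exact: measurableC.
have mv : measurable_fun (~` N) (v : borel E -> R).
  apply: measurable_fun_cvg uvD => n; apply: measurable_funTS.
  exact: sqint_meas.
pose g n (x : borel E) : \bar R := ((u_ n x - u x) ^+ 2)%:E.
have mg n : measurable_fun [set: borel E] (g n).
  apply/measurable_EFinP/measurable_funX/measurable_funB; exact: sqint_meas.
have g0 n x : (~` N) x -> (0 <= g n x)%E by rewrite lee_fin sqr_ge0.
have ig n : (\int[m]_(x in [set: borel E]) g n x = (nrm2 (u_ n - u) ^+ 2)%:E)%E.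
  rewrite sqr_nrm2 /ip /Rintegral fineK.
    by apply: eq_integral => x _; rewrite /g !fctE expr2.
  by apply: integrable_fin_num => //; apply: sqint_mul; exact: sqintB.
have cg : (\int[m]_(x in [set: borel E]) g n x)%E @[n --> \oo] --> 0%E.
  under eq_fun do rewrite ig.
  apply: cvg_EFin; first exact: nearW.
  rewrite -(mulr0 (0 : R)).
  by apply: (@cvgM _ _ _ _ (fun n => nrm2 (u_ n - u)) (fun n => nrm2 (u_ n - u))).
have cgD : (\int[m]_(x in ~` N) g n x)%E @[n --> \oo] --> 0%E.
  apply: (@squeeze_cvge _ _ _ _ (cst 0%E) _ (fun n => \int[m]_(x in [set: borel E]) g n x)%E) => //.
    apply: nearW => n; apply/andP; split; first by apply: integral_ge0 => x; exact: g0.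
    by apply: ge0_subset_integral => // x _; rewrite lee_fin sqr_ge0.
  exact: cvg_cst.
have := @fatou _ _ _ m _ mD g (fun n => measurable_funTS (mg n)) g0.
rewrite [X in (_ <= X)%E](_ : _ = 0%E); last first.
  by rewrite is_cvg_limn_einfE ?(cvg_lim _ cgD)//; apply/cvg_ex; exists 0%E.
rewrite [X in (X <= _)%E](_ : _ = \int[m]_(x in ~` N) `|((v x - u x) ^+ 2)%:E|)%E; last first.
  apply: eq_integral => x /set_mem Dx.
  have cgx : g n x @[n --> \oo] --> ((v x - u x) ^+ 2)%:E.
    apply: cvg_EFin; first exact: nearW.
    have h : u_ n x - u x @[n --> \oo] --> v x - u x.
      by apply: cvgB; [exact: uvD|exact: cvg_cst].
    by rewrite expr2; exact: (cvgM h h).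
  rewrite gee0_abs ?lee_fin ?sqr_ge0//.
  by rewrite is_cvg_limn_einfE ?(cvg_lim _ cgx)//; apply/cvg_ex; eexists; exact: cgx.
move=> le0.
have /(ae_eq_integral_abs m mD _)[] : (\int[m]_(x in ~` N) `|((v x - u x) ^+ 2)%:E| = 0)%E.
  by apply/eqP; rewrite eq_le le0/=; apply: integral_ge0 => x _.
  apply/measurable_EFinP/measurable_funX/measurable_funB => //.
  by apply: measurable_funTS; exact: sqint_meas.
move=> N' [mN' N'0 sN']; exists (N `|` N'); split.
- exact: measurableU.
- exact: null_set_setU.
- move=> x /= vux; have [Nx|Nx] := pselect (N x); [by left|right].
  apply: sN' => /= h; apply: vux; have [/eqP] := h Nx.
  by rewrite sqrf_eq0 subr_eq0 => /eqP.
Qed.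

Lemma opnorm2_ge0 q (S : (E -> R) -> E -> R) : (0 <= opnorm2 m q S)%E.
Proof.
apply: le_trans (Lnorm_ge0 m q (fun x : borel E => (S 0 x)%:E)) _.
apply: ereal_sup_ubound; exists 0 => //; split; first exact: sqint0.
rewrite Lpnorm2E; last exact: sqint0.
by have := nrm2Z 0 sqint0; rewrite scale0r normr0 mul0r => ->; rewrite lee01.
Qed.

Section operator_norm.
Variable S : (E -> R) -> E -> R.
Hypothesis S_sq : forall f, sqint f -> sqint (S f).
Hypothesis S_lin : forall a f g, sqint f -> sqint g ->
  aeq m (S (a *: f + g)) (a *: S f + S g).

Lemma linear_aeZ a f : sqint f -> aeq m (S (a *: f)) (a *: S f).
Proof.
move=> Lf; have := S_lin (a - 1) Lf Lf.
rewrite scalerBl scale1r subrK; apply: filterS => x ->.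
by rewrite !fctE /GRing.scale/=; ring.
Qed.

Lemma linear_aeB f g : sqint f -> sqint g -> aeq m (S (f - g)) (S f - S g).
Proof.
move=> Lf Lg; have := S_lin (- 1) Lg Lf.
rewrite addrC scaleN1r; apply: filterS => x ->.
by rewrite !fctE /GRing.scale/=; ring.
Qed.

Let unit_ball f c : sqint f -> nrm2 f < c ->
  sqint (c^-1 *: f) /\ (Lpnorm m 2%:E (c^-1 *: f) <= 1)%E.
Proof.
move=> Lf fc; have c0 : 0 < c := le_lt_trans (nrm2_ge0 _) fc.
split; first exact: sqintZ.
rewrite Lpnorm2E; last exact: sqintZ.
rewrite nrm2Z// ger0_norm ?invr_ge0 ?(ltW c0)// lee_fin mulrC ler_pdivrMr// mul1r.
exact: ltW.
Qed.

(** With x = |f|: a bound on the unit ball of a seminorm yields the homogeneous bound by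
    scaling with any c > |f|; taking c strictly larger avoids a separate
    treatment of seminorm 0. *)
Lemma le_scaled (x y z : R) : 0 <= x -> 0 <= z ->
  (forall c, x < c -> y <= c * z) -> y <= x * z.
Proof.
move=> x0 z0 h; rewrite leNgt; apply/negP => xzy.
pose d := (y - x * z) / (2 * (z + 1)).
have d0 : 0 < d by rewrite divr_gt0 ?subr_gt0// mulr_gt0// ltr_wpDl.
have := h (x + d); rewrite ltrDl => /(_ d0); apply/negP; rewrite -ltNge.
have -> : (x + d) * z = x * z + d * z by ring.
rewrite -ltrBrDl /d mulrAC ltr_pdivrMr ?mulr_gt0 ?ltr_wpDl//.
have : 0 < y - x * z by rewrite subr_gt0.
nra.
Qed.

Lemma opnorm22_le K f : 0 <= K -> (opnorm2 m 2%:E S <= K%:E)%E -> sqint f ->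
  nrm2 (S f) <= K * nrm2 f.
Proof.
move=> K0 SK Lf; rewrite mulrC.
apply: le_scaled => // [|c fc]; first exact: nrm2_ge0.
have [Lcf cf1] := unit_ball Lf fc.
have c0 : 0 < c := le_lt_trans (nrm2_ge0 _) fc.
have : (Lpnorm m 2%:E (S (c^-1 *: f)) <= K%:E)%E.
  by apply: le_trans SK; apply: ereal_sup_ubound; exists (c^-1 *: f).
rewrite Lpnorm2E; last exact: S_sq.
rewrite (nrm2_aeq (S_sq Lcf) _ (linear_aeZ _ Lf)); last exact/sqintZ/S_sq.
rewrite nrm2Z; last exact: S_sq.
by rewrite lee_fin ger0_norm ?invr_ge0 ?(ltW c0)// ler_pdivrMl.
Qed.

(** The L^oo bound on S f is used through integrals over sets of finite measure
    only, which do not see the choice of a representative. *)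
Lemma opnorm2oo_le f : (opnorm2 m +oo S < +oo)%E -> sqint f ->
  forall A : set (borel E), measurable A -> (m A < +oo)%E ->
  `|ip m (S f) (\1_A : E -> R)| <= nrm2 f * (fine (opnorm2 m +oo S) * fine (m A)).
Proof.
move=> Sfin Lf A mA fA.
set C := opnorm2 m +oo S.
have C_ge0 : (0 <= C)%E := opnorm2_ge0 _ _.
have CE : C = (fine C)%:E by rewrite fineK// ge0_fin_numE.
have C0 : 0 <= fine C by exact: fine_ge0.
have A0 : 0 <= fine (m A) by exact: fine_ge0.
apply: le_scaled => [||c fc]; [exact: nrm2_ge0|exact: mulr_ge0|].
have [Lcf cf1] := unit_ball Lf fc.
have c0 : 0 < c := le_lt_trans (nrm2_ge0 _) fc.
have leC : (Lpnorm m +oo (S (c^-1 *: f)) <= C)%E.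
  by apply: ereal_sup_ubound; exists (c^-1 *: f).
have LSf := S_sq Lf.
have iA := sqint_integrable mA fA LSf.
rewrite ip_indic//.
have Sf_le : {ae m, forall x : borel E, (`|S f x| <= c * fine C)%R}.
  have [m0|m0] := eqVneq (m setT) 0%E.
    by exists setT; split.
  move: leC; rewrite /Lpnorm unlock lt0e m0 measure_ge0/= => /ess_supP h.
  have h2 := linear_aeZ c^-1 Lf.
  near=> x.
  have : (`|(S (c^-1 *: f) x)%:E| <= C)%E by near: x; exact: h.
  have -> : S (c^-1 *: f) x = c^-1 * S f x by near: x; exact: h2.
  by rewrite CE lee_fin normrM gtr0_norm ?invr_gt0// ler_pdivrMl.
rewrite (le_trans (le_normr_Rintegral _ iA))// -lee_fin /Rintegral fineK; last first.
  by apply: integrable_fin_num => //; exact: (integrable_norm iA).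
apply: (@le_trans _ _ (\int[m]_(x in A) (c * fine C)%:E)%E).
  apply: ae_ge0_le_integral => //.
  - apply/measurable_EFinP; apply: measurableT_comp => //.
    exact: measurable_funTS (sqint_meas LSf).
  - by move=> x _; rewrite lee_fin mulr_ge0// ltW.
  - by apply: filterS Sf_le => x /= h _; rewrite lee_fin.
have mAE : m A = (fine (m A))%:E by rewrite fineK// ge0_fin_numE.
by rewrite integral_cst//= [X in (_ * X)%E]mAE -EFinM mulrA.
Unshelve. all: by end_near. Qed.

End operator_norm.

End square_integrable.

(** * Functions on a locally compact separable metric space *)
Section state_space.
Context {R : realType} {E : pmetricType R}.

Lemma continuous_borel {T : ptopologicalType} (f : T -> R) : continuous f ->
  measurable_fun [set: borel T] (f : borel T -> R).
Proof.
move=> cf; apply: (measurability _ (RGenOInfty.measurableE R)).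
move=> _ [_ [a ->] <-]; apply: measurableI => //.
apply: sub_sigma_algebra; move/continuousP : cf; apply.
exact: interval_open.
Qed.

Lemma continuous_borel_map {T U : ptopologicalType} (f : T -> U) :
  continuous f -> measurable_fun [set: borel T] (f : borel T -> borel U).
Proof.
move=> /continuousP cf; apply: (@measurability _ _ (borel T) (borel U) _ _ (@open U)) => // _ [B oB <-].
by rewrite setTI; apply: sub_sigma_algebra; exact: cf.
Qed.

Lemma open_borel (U : set E) : open U -> measurable (U : set (borel E)).
Proof. exact: sub_sigma_algebra. Qed.

Lemma closed_borel (K : set E) : closed K -> measurable (K : set (borel E)).
Proof.
move=> cK; rewrite -[K]setCK; apply: measurableC.
by apply: open_borel; exact: closed_openC.
Qed.

Lemma radon_lty (m : {measure set (borel E) -> \bar R}) (A : set E) : radon m ->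
  measurable (A : set (borel E)) -> compact (closure A) -> (m A < +oo)%E.
Proof.
move=> rm mA kA; apply: le_lt_trans (rm _ kA); apply: le_measure; rewrite ?inE//.
  by apply: closed_borel; exact: closed_closure.
exact: subset_closure.
Qed.

Lemma indic_norm_le1 (A : set E) x : `|\1_A x : R| <= 1.
Proof. by rewrite indicE; case: (_ \in _); rewrite ?normr1 ?normr0 ?ler01. Qed.

Lemma bounded_onP (f : E -> R) :
  [bounded f x | x in [set: E]] <-> exists2 M, 0 <= M & forall x, `|f x| <= M.
Proof.
split=> [[M [Mr hM]]|[M M0 hM]].
  exists (`|M| + 1); first exact: addr_ge0.
  by move=> x; apply: hM => //; rewrite (le_lt_trans (ler_norm M))// ltrDl.
by exists M; split; [exact: num_real|move=> N MN x _ /=; exact/(le_trans (hM x))/ltW].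
Qed.

Lemma locally_compact_ball (x : E) : locally_compact [set: E] ->
  exists2 r : R, 0 < r & compact (closure (ball x r)).
Proof.
move=> lc; have := lc x I; rewrite withinET => -[K nK [kK cK]].
move: nK; rewrite -nbhs_ballE => -[r /= r0 rK]; exists r => //.
apply: (subclosed_compact _ kK); first exact: closed_closure.
by rewrite (closure_id K).1//; exact: closureS.
Qed.

(** E is open in its one-point compactification, so the sets whose image is
    Borel there form a sigma-algebra containing the open sets. *)
Lemma borel_some_image (A : set E) : measurable (A : set (borel E)) ->
  measurable ((Some @` A) : set (borel (opc E))).
Proof.
pose S := [set A : set E | measurable ((Some @` A) : set (borel (opc E)))].
suff : (measurable : set (set (borel E))) `<=` S by exact.
apply: smallest_sub => [|U oU]; last first.
  by apply: sub_sigma_algebra; exact: one_point_compactification_open_some.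
split.
- by rewrite /S /= image_set0.
- move=> B SB; rewrite /S /=.
  rewrite (_ : _ @` _ = (Some @` [set: E] : set (borel (opc E))) `\` (Some @` B)).
    apply: measurableD => //; apply: sub_sigma_algebra.
    exact/one_point_compactification_open_some/openT.
  apply/seteqP; split => y.
    by move=> [x [_ Bx] <-]; split; [exists x|move=> [z Bz [zx]]; apply: Bx; rewrite -zx].
  by move=> [[x _ <-] Bx]; exists x => //; split => // Bx'; apply: Bx; exists x.
- by move=> B SB; rewrite /S /= image_bigcup; exact: bigcupT_measurable.
Qed.

Lemma ext0_borel (f : E -> R) : measurable_fun [set: borel E] (f : borel E -> R) ->
  measurable_fun [set: borel (opc E)] (ext0 f : borel (opc E) -> R).
Proof.
move=> mf _ B mB; rewrite setTI.
have mfB : measurable (f @^-1` B : set (borel E)) by rewrite -[X in measurable X]setTI; exact: mf.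
have mS : measurable ((Some @` [set: E]) : set (borel (opc E))).
  exact: borel_some_image.
have [B0|B0] := pselect (B 0).
  rewrite (_ : _ @^-1` _ = (Some @` (f @^-1` B) : set (borel (opc E))) `|` ~` (Some @` [set: E])).
    apply: measurableU; [exact: borel_some_image|exact: measurableC].
  apply/seteqP; split => [[x|] /= h|[x|] [[y By [yx]]|h]] //=.
  - by left; exists x.
  - by right => -[].
  - by rewrite -yx.
  - by exfalso; apply: h; exists x.
rewrite (_ : _ @^-1` _ = (Some @` (f @^-1` B) : set (borel (opc E)))).
  exact: borel_some_image.
apply/seteqP; split => [[x|] /= h|[x|] [y By [yx]]] //=.
- by exists x.
- by rewrite -yx.
Qed.

Lemma C0_continuous (f : E -> R) : C0 f -> continuous f.
Proof. by case. Qed.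

Lemma C0_supp_compact (f : E -> R) : C0 f -> compact (closure [set x | f x != 0]).
Proof. by case. Qed.

Lemma C0_out (f : E -> R) x : ~ closure [set x | f x != 0] x -> f x = 0.
Proof.
by move=> h; apply/eqP; apply: contra_notT h => fx; exact: subset_closure.
Qed.

(** At the point at infinity, the complement of the compact support is a
    neighbourhood on which the extension is 0. *)
Lemma ext0_continuous (f : E -> R) : C0 f -> continuous (ext0 f : opc E -> R).
Proof.
move=> f0; have [cf kf] := f0; move=> [x|] U /= nU.
  exact: cf.
exists (closure [set x | f x != 0]); first by split => //; exact: closed_closure.
move=> y [[x nx <-]|->] /=; last exact: nbhs_singleton.
by rewrite C0_out//; exact: nbhs_singleton.
Qed.

Lemma C0_bounded (f : E -> R) : C0 f -> exists2 M, 0 <= M & forall x, `|f x| <= M.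
Proof.
move=> f0; have [cf kf] := f0.
have := @compact_bounded _ R _ (continuous_compact (continuous_subspaceT cf) kf).
move=> [M [Mr hM]]; exists (`|M| + 1) => [|x]; first exact: addr_ge0.
have [h|h] := pselect (closure [set x | f x != 0] x).
  by apply: (hM (`|M| + 1)); [rewrite (le_lt_trans (ler_norm M))// ltrDl|exists x].
by rewrite C0_out// normr0 addr_ge0.
Qed.

Lemma C0_borel (f : E -> R) : C0 f -> bounded_borel f.
Proof.
move=> f0; split; first by apply: continuous_borel; exact: C0_continuous.
by apply/bounded_onP; exact: C0_bounded.
Qed.

Lemma C0_sqint (m : {measure set (borel E) -> \bar R}) (f : E -> R) :
  radon m -> C0 f -> sqint m f.
Proof.
move=> rm f0; have [M M0 hM] := C0_bounded f0.
pose K := closure [set x | f x != 0].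
have mK : measurable (K : set (borel E)).
  by apply: closed_borel; exact: closed_closure.
have Kf : (m K < +oo)%E by apply: rm; exact: C0_supp_compact.
apply: (sqint_le _ (sqintZ M (sqint_indic mK Kf))).
  by apply: continuous_borel; exact: C0_continuous.
move=> x; rewrite !fctE /GRing.scale/= indicE.
have [h|h] := pselect (K x).
  by rewrite mem_set// mulr1 (le_trans (hM x))// ler_norm.
by rewrite C0_out// normr0.
Qed.

Lemma C0_lin (a : R) (f g : E -> R) : C0 f -> C0 g -> C0 (a *: f + g).
Proof.
move=> [cf kf] [cg kg]; split.
  move=> x; apply: cvgD; last exact: cg.
  by apply: cvgM; [exact: cvg_cst|exact: cf].
apply: (subclosed_compact _ (compactU kf kg)); first exact: closed_closure.
rewrite -closureU; apply: closureS => x /=; rewrite !fctE /GRing.scale/= => h.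
have [fx|fx] := eqVneq (f x) 0; last by left.
by right; move: h; rewrite fx mulr0 add0r.
Qed.

Lemma C0B (f g : E -> R) : C0 f -> C0 g -> C0 (f - g).
Proof. by move=> f0 g0; rewrite addrC -scaleN1r; exact: C0_lin. Qed.

Lemma bounded_borel_lin (a : R) (f g : E -> R) : bounded_borel f ->
  bounded_borel g -> bounded_borel (a *: f + g).
Proof.
move=> [mf /bounded_onP [M M0 fM]] [mg /bounded_onP [N N0 gN]]; split.
  by apply: measurable_funD => //; exact: measurable_funM.
apply/bounded_onP; exists (`|a| * M + N) => [|x]; first by rewrite addr_ge0 ?mulr_ge0.
by rewrite (le_trans (ler_normD _ _))// lerD// normrM ler_wpM2l.
Qed.

(** Urysohn functions min (n dist (., complement of G), 1) increase to the
    indicator of G; their support lies in the compact closure of G. *)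
Lemma open_indic_approx (G : set E) : open G -> compact (closure G) ->
  exists phi : nat -> E -> R, [/\ forall n, C0 (phi n),
    forall n x, 0 <= phi n x <= \1_G x &
    forall x, phi n x @[n --> \oo] --> (\1_G x : R)].
Proof.
move=> oG kG.
(* The distance to the complement makes sense only if G is not all of E. *)
have [G0|/eqP/setTPn [a Ga]] := pselect (G = setT).
  exists (fun _ => cst 1); split.
  - move=> _; split; first exact: cst_continuous.
    apply: (subclosed_compact _ kG); first exact: closed_closure.
    by rewrite G0; exact: closureS.
  - by move=> n x; rewrite G0 indicT /= lexx ler01.
  - by move=> x; rewrite G0 indicT; exact: cvg_cst.
pose dd (x : E) : R := fine (edist_inf (~` G) x).
have dd_fin x : edist_inf (~` G) x \is a fin_num.
  rewrite ge0_fin_numE; last exact: edist_inf_ge0.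
  apply: (@le_lt_trans _ _ (edist (x, a))).
    by apply: ereal_inf_lbound; exists a.
  rewrite -ge0_fin_numE ?edist_ge0//; apply/edist_finP => /=.
  exists (mdist x a + 1); first by rewrite ltr_wpDl ?mdist_ge0.
  by rewrite ballEmdist /= ltrDl.
have dd0 x : 0 <= dd x by rewrite fine_ge0// edist_inf_ge0.
have cdd : continuous dd.
  by move=> x; apply: fine_cvg; rewrite fineK//; exact: edist_inf_continuous.
have ddG x : ~ G x -> dd x = 0 by move=> Gx; rewrite /dd edist_inf0.
have ddG' x : G x -> 0 < dd x.
  move=> Gx; have := oG; rewrite openE => /(_ x Gx); rewrite /interior -nbhs_ballE => -[r /= r0 rG].
  rewrite -lte_fin /dd fineK// (@lt_le_trans _ _ r%:E)//.
  apply: le_ereal_inf_tmp => _ [b Gb <-]; rewrite leNgt; apply/negP => /edist_lt_ball /= /rG.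
  exact: Gb.
pose phi n x := Num.min (n%:R * dd x) 1.
have phi_ge0 n x : 0 <= phi n x by rewrite /phi le_min ler01 mulr_ge0.
have phi_out n x : ~ G x -> phi n x = 0.
  by move=> Gx; rewrite /phi ddG// mulr0 min_l.
exists phi; split.
- move=> n; split.
    move=> x; apply: (@continuous_min _ _ (fun x => n%:R * dd x) (cst 1)).
      by apply: continuousM; [exact: cst_continuous|exact: cdd].
    exact: cst_continuous.
  apply: (subclosed_compact _ kG); first exact: closed_closure.
  by apply: closureS => x /=; apply: contra_neqP => /phi_out.
- move=> n x; rewrite phi_ge0 indicE.
  have [Gx|Gx] := pselect (G x); first by rewrite mem_set// /phi ge_min lexx orbT.
  by rewrite memNset// phi_out// lexx.
- move=> x; have [Gx|Gx] := pselect (G x); last first.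
    by rewrite indicE memNset//; under eq_fun do rewrite phi_out//; exact: cvg_cst.
  rewrite indicE mem_set//=; apply: cvg_near_cst.
  near=> n; rewrite /phi min_r// -ler_pdivrMr ?ddG'//.
  by near: n; exact: nbhs_infty_ger.
Unshelve. all: by end_near. Qed.

Lemma metric_ball_open (x : E) (r : R) : open (ball x r).
Proof.
rewrite openE => y; rewrite ballEmdist /= => xyr; rewrite /interior -nbhs_ballE.
exists (r - mdist x y); rewrite /= ?subr_gt0// => z.
rewrite !ballEmdist /= ltrBrDl; apply: le_lt_trans; exact: (metric_triangle x y z).
Qed.

(** The balls of radius 1 / (k + 1) with relatively compact closure around the
    points of a countable dense set cover E; the exhaustion consists of their
    finite unions. *)
Lemma open_exhaustion : locally_compact [set: E] -> separable E ->
  exists V : nat -> set E, [/\ forall n, open (V n),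
    forall n, compact (closure (V n)),
    forall n k, (n <= k)%N -> V n `<=` V k & forall x, exists n, V n x].
Proof.
move=> lc [D cD dD].
have /countable_injP [f fD] := cD.
(* The ball of radius 1 / (p.2 + 1) around the point of D with number p.1, or
   the empty set if there is no such point or if its closure is not compact. *)
pose U (p : nat * nat) : set E := [set y | exists x, [/\ D x, f x = p.1,
  compact (closure (ball x p.2.+1%:R^-1)) & ball x p.2.+1%:R^-1 y]].
have U_box p : U p = set0 \/ exists x,
    compact (closure (ball x (p.2.+1%:R^-1 : R))) /\ U p = ball x p.2.+1%:R^-1.
  have [[x [Dx fx kx]]|nx] := pselect (exists x, [/\ D x, f x = p.1 &
      compact (closure (ball x (p.2.+1%:R^-1 : R)))]); [right|left].
    exists x; split => //; apply/seteqP; split => y; last by move=> h; exists x.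
    by move=> [x' [Dx' fx' _]]; rewrite (fD x x') ?inE// fx fx'.
  by apply/seteqP; split => // y [x [Dx fx kx _]]; apply: nx; exists x.
have oU p : open (U p).
  by case: (U_box p) => [->|[x [_ ->]]]; [exact: open0|exact: metric_ball_open].
have kU p : compact (closure (U p)).
  by case: (U_box p) => [->|[x [? ->]]//]; rewrite closure0; exact: compact0.
pose W n : set E := if unpickle n is Some p then U p else set0.
have oW n : open (W n) by rewrite /W; case: unpickle => //; exact: open0.
have kW n : compact (closure (W n)).
  by rewrite /W; case: unpickle => //; rewrite closure0; exact: compact0.
exists (fun n => \big[setU/set0]_(i < n) W i); split.
- move=> n; elim: n => [|n IH]; first by rewrite big_ord0; exact: open0.
  by rewrite big_ord_recr /=; exact: openU.
- move=> n; elim: n => [|n IH]; first by rewrite big_ord0 closure0; exact: compact0.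
  by rewrite big_ord_recr /= closureU; exact: compactU.
- move=> n k /subnK <-; elim: (k - n)%N => // j IH x /IH.
  by rewrite addSn big_ord_recr /=; left.
- move=> y; have [r r0 kr] := locally_compact_ball y lc.
  near \oo => k.
  have kr2 : (k.+1%:R^-1 : R) * 2 < r.
    rewrite -ltr_pdivlMr//; near: k; exact: near_infty_natSinv_lt (PosNum (divr_gt0 r0 (ltr0n _ 2))).
  have [x [xy Dx]] : (ball y (k.+1%:R^-1 : R) `&` D) !=set0.
    apply: dD; first by exists y; exact: ballxx.
    exact: metric_ball_open.
  have xyk : ball x k.+1%:R^-1 y by exact: ball_sym.
  exists (pickle (f x, k)).+1; rewrite big_ord_recr /=; right.
  rewrite /W pickleK; exists x; split => //=.
  apply: (subclosed_compact _ kr); first exact: closed_closure.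
  apply: closureS => z xz; apply: (@le_ball _ _ y (k.+1%:R^-1 * 2)); first exact: ltW.
  by rewrite mulr2n mulrDr mulr1; apply: ball_triangle xz.
Unshelve. all: by end_near. Qed.

End state_space.

(** * The transition function of a Hunt process *)
Lemma probability1_setC d (T : measurableType d) (R : realType)
    (Q : probability T R) (N : set T) :
  measurable N -> Q N = 1%E -> Q (~` N) = 0%E.
Proof. by move=> mN N1; rewrite probability_setC// N1 subee. Qed.

Section add_bound.
Context {R : realType}.
Implicit Types M : R.

Lemma addM_ge0 T (g : T -> R) M : (forall z, `|g z| <= M) -> forall z, 0 <= g z + M.
Proof. by move=> gM z; have := gM z; rewrite ler_norml => /andP[]; lra. Qed.

Lemma addM_le T (g : T -> R) M : (forall z, `|g z| <= M) -> forall z, `|g z + M| <= M + M.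
Proof.
move=> gM z; rewrite ger0_norm; last exact: addM_ge0.
by have := gM z; rewrite ler_norml => /andP[]; lra.
Qed.

End add_bound.

Section transition_kernel.
Context {R : realType} {E : pmetricType R}.
Context {d : measure_display} {Omega : measurableType d}.
Variables (X : \bar R -> Omega -> opc E) (P : opc E -> probability Omega R).
Variable Ft : R -> set (set Omega).
Hypothesis HP : hunt_process_wrt X P Ft.
Local Notation S := (borel (opc E)).

Lemma hunt_measurable t : 0 <= t -> measurable_fun [set: Omega] (X t%:E : Omega -> S).
Proof.
move=> t0 _ B mB; rewrite setTI.
by apply: (filt_sub (hunt_filt HP) t0); exact: (filt_adapted (hunt_filt HP)).
Qed.

Section kernel.
Variables (t : R) (t0 : 0 <= t).

(** The law of X_t under P_y, as a probability kernel on the compactified state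
    space, so that integrals against it depend measurably on y. *)
Definition law (y : S) : {measure set S -> \bar R} :=
  measure_function_pushforward__canonical__measure_function_Measure (P y) (hunt_measurable t0).

Let law_measurable U : measurable U -> measurable_fun [set: S] (law ^~ U).
Proof. exact: (hunt_meas HP). Qed.

HB.instance Definition _ := isKernel.Build _ _ S S R law law_measurable.

Let law_prob y : law y [set: S] = 1%E.
Proof. by rewrite /law /= /pushforward preimage_setT probability_setT. Qed.

HB.instance Definition _ := Kernel_isProbability.Build _ _ S S R law law_prob.

(** Composition of kernels lets the second kernel depend on the starting point
    as well; a Markov kernel only looks at the intermediate point. *)
Definition law2 (p : S * S) : {measure set S -> \bar R} := law p.2.

Let law2_measurable U : measurable U -> measurable_fun [set: S * S] (law2 ^~ U).
Proof.
by move=> mU; apply: (measurableT_comp (law_measurable mU)); exact: measurable_snd.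
Qed.

HB.instance Definition _ := isKernel.Build _ _ (S * S)%type S R law2 law2_measurable.

Let law2_prob y : law2 y [set: S] = 1%E.
Proof. exact: law_prob. Qed.

HB.instance Definition _ := Kernel_isProbability.Build _ _ (S * S)%type S R law2 law2_prob.

Lemma law_measurable_integral (g : S -> \bar R) : (forall y, (0 <= g y)%E) ->
  measurable_fun [set: S] g -> measurable_fun [set: S] (fun y => \int[law y]_z g z)%E.
Proof. by move=> g0 mg; exact: measurable_fun_integral_kernel. Qed.

Lemma law_integral (g : S -> \bar R) y : (forall y, (0 <= g y)%E) ->
  measurable_fun [set: S] g ->
  (\int[law y]_z g z = \int[P y]_w g (X t%:E w))%E.
Proof.
move=> g0 mg; rewrite ge0_integral_pushforward//.
exact: hunt_measurable.
Qed.

End kernel.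

Lemma stopping_time_cst t : 0 <= t -> stopping_time Ft (fun=> t%:E).
Proof.
move=> t0; split=> [w|r r0]; first by rewrite lee_fin.
have [F0 FC FU] := filt_sigma (hunt_filt HP) r0.
have [tr|rt] := leP t r.
  rewrite (_ : [set _ | _] = setT); first by rewrite -(setD0 setT); exact: FC.
  by apply/seteqP; split => // w _; rewrite /= lee_fin.
rewrite (_ : [set _ | _] = set0)//.
by apply/seteqP; split => // w; rewrite /= lee_fin leNgt rt.
Qed.

Lemma stopped_setT t : 0 <= t -> stopped Ft (fun=> t%:E) [set: Omega].
Proof.
move=> t0; split => // r r0; rewrite setTI.
exact: (stopping_time_cst t0).2.
Qed.

(** Chapman-Kolmogorov: the strong Markov property at the constant stopping
    time t, on the whole sample space. *)
Lemma law_markov t s (t0 : 0 <= t) (s0 : 0 <= s) (ts0 : 0 <= t + s) (y : S) (B : set S) :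
  measurable B -> law ts0 y B = kcomp (law t0) (law2 s0) y B.
Proof.
move=> mB; rewrite /kcomp law_integral//; last first.
  exact: measurable_kernel (law s0) B mB.
have := hunt_strong_markov HP y (stopping_time_cst t0) s0 (stopped_setT t0) mB.
by rewrite setTI /= => <-.
Qed.

Lemma hunt_markov_ge0 t s (g : S -> \bar R) y : 0 <= t -> 0 <= s ->
  (forall y, (0 <= g y)%E) -> measurable_fun [set: S] g ->
  (\int[P y]_w g (X (t + s)%:E w) =
   \int[P y]_w \int[P (X t%:E w)]_v g (X s%:E v))%E.
Proof.
move=> t0 s0 g0 mg; have ts0 := addr_ge0 t0 s0.
rewrite -(law_integral ts0)//.
have lE U : measurable U -> U `<=` setT -> law ts0 y U = (mkcomp (law t0) (law2 s0) y) U.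
  by move=> mU _; exact: law_markov.
rewrite (eq_measure_integral _ lE) /mkcomp integral_kcomp//.
rewrite law_integral; last 2 first.
- by move=> z; exact: integral_ge0.
- exact: law_measurable_integral.
by apply: eq_integral => w _; rewrite -(law_integral s0).
Qed.

Definition expect t (g : S -> R) (y : S) : R := \int[P y]_w g (X t%:E w).

Lemma expect_integrable t (g : S -> R) y M : 0 <= t ->
  measurable_fun [set: S] g -> (forall z, `|g z| <= M) ->
  (P y).-integrable setT (EFin \o (fun w => g (X t%:E w))).
Proof.
move=> t0 mg gM.
have iM : (P y).-integrable [set: Omega] (EFin \o cst M).
  exact: finite_measure_integrable_cst.
apply: (integrable_dominated _ _ iM) => //.
by apply: (measurableT_comp mg); exact: hunt_measurable.
Qed.

Lemma expect_cst t c y : expect t (fun=> c) y = c.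
Proof.
rewrite /expect; transitivity (c * fine (P y setT)); first exact: Rintegral_cst.
by rewrite probability_setT mulr1.
Qed.

Lemma expect_le t (g : S -> R) y M : 0 <= t -> measurable_fun [set: S] g ->
  (forall z, `|g z| <= M) -> `|expect t g y| <= M.
Proof.
move=> t0 mg gM; have ig := expect_integrable y t0 mg gM.
rewrite (le_trans (le_normr_Rintegral _ ig))// -[leRHS](expect_cst t M y).
apply: le_Rintegral => //; first exact: (integrable_norm ig).
exact: finite_measure_integrable_cst.
Qed.

Lemma expect_lin t c (g h : S -> R) y M N : 0 <= t ->
  measurable_fun [set: S] g -> measurable_fun [set: S] h ->
  (forall z, `|g z| <= M) -> (forall z, `|h z| <= N) ->
  expect t (fun z => c * g z + h z) y = c * expect t g y + expect t h y.
Proof.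
move=> t0 mg mh gM hN; rewrite /expect RintegralD//.
- by rewrite RintegralZl//; exact: (expect_integrable _ _ mg gM).
- by apply: integrable_EFinZ => //; exact: (expect_integrable _ _ mg gM).
- exact: (expect_integrable _ _ mh hN).
Qed.

(** Reduces statements on bounded functions to nonnegative ones, for which the
    kernel integrals are available without integrability conditions. *)
Lemma expect_addM t (g : S -> R) y M : 0 <= t ->
  measurable_fun [set: S] g -> (forall z, `|g z| <= M) ->
  expect t g y = expect t (fun z => g z + M) y - M.
Proof.
move=> t0 mg gM.
have := @expect_lin t 1 g (fun=> M) y M `|M| t0 mg (measurable_cst _) gM (fun _ => lexx _).
rewrite expect_cst mul1r => h; rewrite (_ : (fun z => g z + M) = (fun z => 1 * g z + M)).
  by rewrite h addrK.
by apply/funext => z; rewrite mul1r.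
Qed.

Lemma expect_fineK t (g : S -> R) y M : 0 <= t -> measurable_fun [set: S] g ->
  (forall z, `|g z| <= M) ->
  (expect t g y)%:E = (\int[P y]_w (g (X t%:E w))%:E)%E.
Proof.
move=> t0 mg gM; rewrite /expect /Rintegral fineK//.
by apply: integrable_fin_num => //; exact: (expect_integrable _ t0 mg gM).
Qed.

Lemma expect_measurable t (g : S -> R) M : 0 <= t -> measurable_fun [set: S] g ->
  (forall z, `|g z| <= M) -> measurable_fun [set: S] (expect t g).
Proof.
move=> t0 mg gM.
have mgM : measurable_fun [set: S] (fun z => g z + M) by exact: measurable_funD.
rewrite (_ : expect t g = fun y => expect t (fun z => g z + M) y - M); last first.
  by apply/funext => y; exact: expect_addM.
apply: measurable_funB => //; apply/measurable_EFinP.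
rewrite (_ : _ \o _ = fun y => (\int[law t0 y]_z (g z + M)%:E)%E).
  apply: law_measurable_integral; last exact/measurable_EFinP.
  by move=> z; rewrite lee_fin addM_ge0.
apply/funext => y /=; rewrite (expect_fineK _ t0 mgM (addM_le gM)).
rewrite law_integral//; first by move=> z; rewrite lee_fin addM_ge0.
exact/measurable_EFinP.
Qed.

Lemma expect_markov t s (g : S -> R) y M : 0 <= t -> 0 <= s ->
  measurable_fun [set: S] g ->
  (forall z, `|g z| <= M) -> expect (t + s) g y = expect t (expect s g) y.
Proof.
move=> t0 s0 mg gM; have ts0 := addr_ge0 t0 s0.
have mgM : measurable_fun [set: S] (fun z => g z + M) by exact: measurable_funD.
have gM2 := addM_le gM.
have ms := expect_measurable s0 mgM gM2.
have msM z := expect_le z s0 mgM gM2.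
rewrite (expect_addM _ ts0 mg gM).
have -> : expect s g = fun z => 1 * expect s (fun z => g z + M) z + - M.
  by apply/funext => z; rewrite mul1r; exact: expect_addM.
rewrite (@expect_lin t 1 _ (fun=> - M) y _ `|- M| t0 ms (measurable_cst _) msM (fun _ => lexx _)).
rewrite expect_cst mul1r; congr (_ - _); apply: EFin_inj.
rewrite (expect_fineK _ ts0 mgM gM2) (expect_fineK _ t0 ms msM).
have g0 z : (0 <= (g z + M)%:E)%E by rewrite lee_fin addM_ge0.
rewrite (hunt_markov_ge0 y t0 s0 g0); last exact/measurable_EFinP.
by apply: eq_integral => w _; rewrite (expect_fineK _ s0 mgM gM2).
Qed.

Lemma expect_cvg t (g_ : nat -> S -> R) (g : S -> R) y M : 0 <= t ->
  (forall n, measurable_fun [set: S] (g_ n)) -> (forall n z, `|g_ n z| <= M) ->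
  (forall z, g_ n z @[n --> \oo] --> g z) ->
  expect t (g_ n) y @[n --> \oo] --> expect t g y.
Proof.
move=> t0 mg gM cg.
have iM : (P y).-integrable [set: Omega] (EFin \o cst M).
  exact: finite_measure_integrable_cst.
apply: (Rintegral_dominated_cvg _ _ _ iM) => //.
by move=> n; apply: (measurableT_comp (mg n)); exact: hunt_measurable.
Qed.

Lemma expect_right_continuous (g : opc E -> R) y M t : 0 <= t ->
  continuous g -> (forall z, `|g z| <= M) ->
  expect r g y @[r --> t^'+] --> expect t g y.
Proof.
move=> t0 cg gM; apply/cvg_at_rightP => u [ut cu].
have iM : (P y).-integrable [set: Omega] (EFin \o cst M).
  exact: finite_measure_integrable_cst.
apply: (Rintegral_dominated_cvg _ _ _ iM) => //.
- move=> n; apply: (measurableT_comp (continuous_borel cg)).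
  by apply: hunt_measurable; exact/ltW/(le_lt_trans t0).
- move=> w _.
  have u_right : u n @[n --> \oo] --> t^'+.
    move=> U hU; have h : \forall n \near \oo, t < u n -> U (u n) := cu _ hU.
    by apply: filterS h => n; apply.
  have Xu : X (u n)%:E w @[n --> \oo] --> X t%:E w.
    have Xr := hunt_right_cont HP (w := w) t0.
    exact: (@cvg_comp _ _ _ u (fun s => X s%:E w) _ _ _ u_right Xr).
  exact: (cvg_comp _ _ Xu (cg _)).
Qed.

(** The process started at the cemetery stays there, so functions extended by 0
    form an invariant class and P_t on E satisfies the semigroup law. *)
Lemma expect_cemetery t (f : E -> R) : 0 <= t ->
  measurable_fun [set: borel E] (f : borel E -> R) -> expect t (ext0 f) None = 0.
Proof.
move=> t0 mf; pose N := [set w | X t%:E w = None].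
have mN : measurable N.
  have mS : measurable ((Some @` [set: E]) : set S) by exact: borel_some_image.
  rewrite (_ : N = setT `&` (X t%:E : Omega -> S) @^-1` (~` (Some @` [set: E]))).
    by apply: hunt_measurable => //; exact: measurableC.
  rewrite setTI; apply/seteqP; split => w; rewrite /N /=.
    by move=> -> [].
  by case: (X t%:E w) => // x h; exfalso; apply: h; exists x.
have N1 : P None N = 1%E := hunt_cemetery HP t0.
rewrite /expect /Rintegral -[RHS]/(fine 0%E); congr fine.
rewrite -(integral0 (P None) [set: Omega]).
apply: ae_eq_integral => //.
  by apply/measurable_EFinP; apply: (measurableT_comp (ext0_borel mf)); exact: hunt_measurable.
exists (~` N); split; first exact: measurableC.
- exact: probability1_setC.
- by move=> w /= hw Nw; apply: hw => _; rewrite Nw.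
Qed.

Lemma ext0_le (f : E -> R) M : 0 <= M -> (forall x, `|f x| <= M) -> forall y, `|ext0 f y| <= M.
Proof. by move=> M0 fM [x|] //=; rewrite normr0. Qed.

Lemma transition_le t f M : 0 <= t -> bounded_borel f -> 0 <= M -> (forall x, `|f x| <= M) ->
  forall x, `|transition X P t f x| <= M.
Proof.
by move=> t0 [mf _] M0 fM x; apply: expect_le (ext0_borel mf) (ext0_le M0 fM).
Qed.

Lemma transition_ext0 t f : 0 <= t -> bounded_borel f ->
  ext0 (transition X P t f) = expect t (ext0 f).
Proof.
by move=> t0 [mf _]; apply/funext => -[x|] //=; rewrite expect_cemetery.
Qed.

Lemma transition_bounded_borel t f : 0 <= t -> bounded_borel f ->
  bounded_borel (transition X P t f).
Proof.
move=> t0 bf; have [mf /bounded_onP [M M0 fM]] := bf; split; last first.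
  by apply/bounded_onP; exists M => //; exact: transition_le.
have me := expect_measurable t0 (ext0_borel mf) (ext0_le M0 fM).
apply: (measurable_comp measurableT _ me) => //.
exact: (continuous_borel_map one_point_compactification_some_continuous).
Qed.

Lemma transition_markov s t f x : 0 <= s -> 0 <= t -> bounded_borel f ->
  transition X P (s + t) f x = transition X P s (transition X P t f) x.
Proof.
move=> s0 t0 bf; have [mf /bounded_onP [M M0 fM]] := bf.
rewrite {2}/transition transition_ext0// -/(expect _ _ _).
exact: expect_markov (ext0_borel mf) (ext0_le M0 fM).
Qed.

Lemma transition_right_continuous f x t : 0 <= t -> C0 f ->
  transition X P r f x @[r --> t^'+] --> transition X P t f x.
Proof.
move=> t0 f0; have [M M0 fM] := C0_bounded f0.
exact: expect_right_continuous (ext0_continuous f0) (ext0_le M0 fM).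
Qed.

Lemma transition_cvg t (f_ : nat -> E -> R) f M x : 0 <= t ->
  (forall n, measurable_fun [set: borel E] (f_ n : borel E -> R)) ->
  0 <= M -> (forall n x, `|f_ n x| <= M) ->
  (forall x, f_ n x @[n --> \oo] --> f x) ->
  transition X P t (f_ n) x @[n --> \oo] --> transition X P t f x.
Proof.
move=> t0 mf M0 fM cf; apply: (@expect_cvg t (fun n => ext0 (f_ n)) (ext0 f) (Some x) M t0).
- by move=> n; exact: ext0_borel.
- by move=> n; exact: ext0_le.
- by move=> [z|]; [exact: cf|exact: cvg_cst].
Qed.

Lemma transition_lin t c f g x : 0 <= t -> bounded_borel f -> bounded_borel g ->
  transition X P t (c *: f + g) x = c * transition X P t f x + transition X P t g x.
Proof.
move=> t0 [mf /bounded_onP [M M0 fM]] [mg /bounded_onP [N N0 gN]].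
rewrite -(expect_lin c _ t0 (ext0_borel mf) (ext0_borel mg) (ext0_le M0 fM) (ext0_le N0 gN)).
by congr (expect t _ _); apply/funext => -[z|] //=; rewrite mulr0 addr0.
Qed.

Lemma transition_ge0 t f x : (forall x, 0 <= f x) -> 0 <= transition X P t f x.
Proof. by move=> f0; apply: Rintegral_ge0 => w _; case: (X _ _) => /=. Qed.

End transition_kernel.

(** * The semigroup on L2 and the association with the process *)
Section semigroup.
Context {R : realType} {E : pmetricType R}.
Variable m : {measure set (borel E) -> \bar R}.
Variables (F : set (E -> R)) (Ef : (E -> R) -> (E -> R) -> R) (alpha0 : R).
Variable T : R -> (E -> R) -> E -> R.
Hypothesis alpha0_ge0 : 0 <= alpha0.
Hypothesis HT : semigroup_of_form m F Ef T alpha0.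
Local Notation sqint := (sqint m).
Local Notation nrm2 := (nrm2 m).
Local Notation D := (`[0%R, +oo[%classic : set R).

Lemma T_sqint t f : 0 <= t -> sqint f -> sqint (T t f).
Proof. exact: (sg_L2 HT). Qed.

Lemma T_norm t f : 0 <= t -> sqint f -> nrm2 (T t f) <= expR (alpha0 * t) * nrm2 f.
Proof.
move=> t0 Lf; apply: (@opnorm22_le _ _ m (T t)) => //.
- by move=> g; exact: T_sqint.
- by move=> a g h Lg Lh; exact: (sg_lin HT).
- exact: (sg_norm HT).
Qed.

Lemma T_sub t f g : 0 <= t -> sqint f -> sqint g -> aeq m (T t (f - g)) (T t f - T t g).
Proof.
move=> t0 Lf Lg; apply: (@linear_aeB _ _ m (T t)) => //.
by move=> a u v Lu Lv; exact: (sg_lin HT).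
Qed.

Lemma ip_T_sub t f g v : 0 <= t -> sqint f -> sqint g -> sqint v ->
  ip m (T t (f - g)) v = ip m (T t f) v - ip m (T t g) v.
Proof.
move=> t0 Lf Lg Lv; have [LTf LTg] := (T_sqint t0 Lf, T_sqint t0 Lg).
rewrite -ipBl//.
by apply: (ip_aeql _ _ Lv (T_sub t0 Lf Lg)); [exact/T_sqint/sqintB|exact: sqintB].
Qed.

Lemma T_continuous0 f e : sqint f -> 0 < e ->
  exists2 d, 0 < d & forall s, 0 <= s -> s < d -> nrm2 (T s f - f) <= e.
Proof.
move=> Lf e0; have := sg_cont HT Lf.
move=> /fine_cvgP[_] /cvgrPdist_le /(_ e e0); rewrite near_withinE => -[d /= d0 hd].
exists d => // s; rewrite le_eqVlt => /predU1P[<- _|s0 sd].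
  have -> : nrm2 (T 0 f - f) = 0; last exact: ltW.
  have L0 : sqint (T 0 f - f) by apply: sqintB => //; exact: T_sqint.
  rewrite (nrm2_aeq L0 (sqint0 m)).
    by have := nrm2Z 0 (sqint0 m); rewrite scale0r normr0 mul0r.
  by apply: filterS (sg_0 HT Lf) => x; rewrite !fctE => ->; rewrite subrr.
have := hd s; rewrite /ball_ /= sub0r normrN (ger0_norm (ltW s0)) => /(_ sd s0).
rewrite sub0r normrN => h.
have Ls : sqint (T s f - f) by apply: sqintB => //; apply: T_sqint => //; exact: ltW.
by move: h; rewrite Lpnorm2E//= ger0_norm// nrm2_ge0.
Qed.

(** By the semigroup law, T_r f - T_s f = T_s (T_(r - s) f - f) for r > s. *)
Lemma ip_T_right_continuous f v s : 0 <= s -> sqint f -> sqint v ->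
  ip m (T r f) v @[r --> s^'+] --> ip m (T s f) v.
Proof.
move=> s0 Lf Lv; apply/cvgrPdist_le => e e0.
pose K := expR (alpha0 * s) * (nrm2 v + 1).
have K0 : 0 < K by rewrite mulr_gt0 ?expR_gt0// ltr_wpDl ?nrm2_ge0.
have [d d0 hd] := T_continuous0 Lf (divr_gt0 e0 K0).
near=> r.
have sr : s < r by near: r; exact: nbhs_right_gt.
have rs : r < s + d by near: r; apply: nbhs_right_lt; rewrite ltrDl.
have h0 : 0 <= r - s by rewrite subr_ge0 ltW.
have r0 : 0 <= r by exact/ltW/(le_lt_trans s0).
have Lh : sqint (T (r - s) f) by exact: T_sqint.
have -> : ip m (T r f) v = ip m (T s (T (r - s) f)) v.
  apply: ip_aeql => //; [exact: T_sqint|exact: T_sqint|].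
  by have := sg_D HT s0 h0 Lf; rewrite addrC subrK.
rewrite distrC -ip_T_sub//.
have LhB : sqint (T (r - s) f - f) by exact: sqintB.
rewrite (le_trans (cauchy_schwarz (T_sqint s0 LhB) Lv))//.
have hrs : nrm2 (T (r - s) f - f) <= e / K by apply: hd => //; rewrite ltrBlDl.
apply: (@le_trans _ _ (expR (alpha0 * s) * (e / K) * nrm2 v)).
  rewrite ler_wpM2r ?nrm2_ge0// (le_trans (T_norm s0 LhB))//.
  by rewrite ler_wpM2l ?expR_ge0.
rewrite [leLHS](_ : _ = e * (nrm2 v / (nrm2 v + 1))); last first.
  by rewrite /K; field; rewrite !gt_eqF ?expR_gt0// ltr_wpDl ?nrm2_ge0.
rewrite ler_piMr// ?(ltW e0)// ler_pdivrMr ?ltr_wpDl ?nrm2_ge0// mul1r lerDl//.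
Unshelve. all: by end_near. Qed.

Lemma ip_T_growth f v : sqint f -> sqint v ->
  exp_growth alpha0 (nrm2 f * nrm2 v) (fun s => ip m (T s f) v).
Proof.
move=> Lf Lv; split.
  by apply: right_continuous_measurable => s s0; exact: ip_T_right_continuous.
move=> s s0; rewrite (le_trans (cauchy_schwarz (T_sqint s0 Lf) Lv))//.
by rewrite mulrAC ler_wpM2r ?nrm2_ge0// mulrC T_norm.
Qed.

Lemma resolvent_ip alpha f : alpha0 < alpha -> sqint f ->
  exists2 g, sqint g & forall v, sqint v ->
    ip m g v = laplace alpha (fun s => ip m (T s f) v).
Proof. by move=> al Lf; have [g [[Lg hg] _ _]] := sg_resolvent HT al Lf; exists g. Qed.

Lemma time_integral_laplace alpha f h n v : time_integral m T alpha `[0, n%:R] f h ->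
  sqint v ->
  ip m h v = laplace alpha (fun s => (\1_(`[0, n%:R]) s) * ip m (T s f) v).
Proof.
move=> [Lh hh] Lv; rewrite hh// /laplace.
rewrite [in LHS](_ : (`[0, n%:R]%classic : set R) = D `&` `[0, n%:R]); last first.
  by rewrite setIidr// => s /=; rewrite !in_itv/= => /andP[-> _].
rewrite Rintegral_mkcondr; apply: eq_Rintegral => s _; rewrite patchE indicE.
by case: ifPn => _; rewrite ?mul1r ?mul0r ?mulr0.
Qed.

(** The resolvent on L^oo is a monotone limit of truncated time integrals
    h_n of T_s f_n over [0, n], with f_n increasing to u. For a square-integrable
    u and alpha > alpha0 it agrees with the resolvent h on L2. Indeed
    |h_n - h|^2 is a Laplace transform, so that the growth bound on T_s gives
    |h_n - h| <= B n with B n tending to 0, and the a.e. limit of h_n is h. *)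
Lemma Linfty_resolvent_ge0_unique alpha u g h : alpha0 < alpha ->
  sqint u -> Linfty_resolvent_ge0 m T alpha u g -> sqint h ->
  (forall v, sqint v -> ip m h v = laplace alpha (fun s => ip m (T s u) v)) ->
  aeq m g h.
Proof.
move=> al Lu [f_ [h_ [Lf_ f0 fu hh hg]]] Lh hE.
have Lf n : sqint (f_ n) := Lf_ n.
have f_le n x : `|f_ n x| <= `|u x|.
  have fx0 k : 0 <= f_ k x by have /andP[] := f0 k x.
  have fn : f_ n x <= u x.
    rewrite -(cvg_lim _ (fu x))//; apply: nondecreasing_cvgn_le.
      by apply/nondecreasing_seqP => k; have /andP[] := f0 k x.
    exact: (cvgP _ (fu x)).
  by rewrite !ger0_norm//; exact: le_trans fn.
have fuN : nrm2 (f_ n - u) @[n --> \oo] --> (0 : R).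
  by apply: (nrm2_dominated_cvg _ Lu Lu fu f_le) => n; exact: (sqint_meas (Lf n)).
have Lh_ n : sqint (h_ n) by have [] := hh n.
apply: (nrm2_cvg_ae_unique Lh_ Lh _ hg).
(* Half of the gap alpha - alpha0 ensures integrability, the other half makes
   the tail of the time integral beyond n of order exp (- n d). *)
pose d := (alpha - alpha0) / 2.
have d0 : 0 < d by rewrite divr_gt0// subr_gt0.
pose B n := (nrm2 (f_ n - u) + expR (- (n%:R * d)) * nrm2 u) / d.
have B0 n : 0 <= B n.
  by rewrite divr_ge0 ?(ltW d0)// addr_ge0 ?mulr_ge0 ?expR_ge0 ?nrm2_ge0.
have le_B n : nrm2 (h_ n - h) <= B n.
  set w := h_ n - h.
  have Lw : sqint w by exact: sqintB.
  have LfB : sqint (f_ n - u) by exact: sqintB.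
  pose phi s := \1_(`[0, n%:R]) s * ip m (T s (f_ n)) w - ip m (T s u) w.
  have wE : ip m w w = laplace alpha phi.
    rewrite ipBl// (time_integral_laplace (hh n))// hE//.
    rewrite -(laplaceB (M1 := 1 * (nrm2 (f_ n) * nrm2 w)) _ (ip_T_growth Lu Lw) al)//.
    apply: exp_growthM (ip_T_growth (Lf n) Lw) _ _.
      exact: measurable_indic.
    by move=> s _; rewrite indicE; case: (_ \in _); rewrite ?normr1 ?normr0 ?ler01.
  have gphi : exp_growth (alpha0 + d) (d * B n * nrm2 w) phi.
    split.
      apply: measurable_funB; last exact: growth_meas (ip_T_growth Lu Lw).
      apply: measurable_funM; first exact: measurable_indic.
      exact: growth_meas (ip_T_growth (Lf n) Lw).
    have dB : d * B n = nrm2 (f_ n - u) + expR (- (n%:R * d)) * nrm2 u.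
      by rewrite /B mulrCA mulfV ?mulr1// gt_eqF.
    move=> s s0; rewrite /phi dB.
    have ip_le g' : sqint g' -> `|ip m (T s g') w| <= expR (alpha0 * s) * nrm2 g' * nrm2 w.
      move=> Lg'; rewrite (le_trans (cauchy_schwarz (T_sqint s0 Lg') Lw))//.
      by rewrite ler_wpM2r ?nrm2_ge0// T_norm.
    have Nu := nrm2_ge0 m u; have Nw := nrm2_ge0 m w; have Nf := nrm2_ge0 m (f_ n - u).
    rewrite indicE; have [sn|ns] := leP s n%:R.
      rewrite mem_set/= ?in_itv/= ?s0// mul1r -ip_T_sub//.
      rewrite (le_trans (ip_le _ LfB))// [leRHS]mulrAC ler_wpM2r// mulrC ler_pM ?expR_ge0//.
        by rewrite lerDl mulr_ge0// expR_ge0.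
      by rewrite ler_expR ler_wpM2r// lerDl ltW.
    have nin : ~ `[0, n%:R]%classic s by rewrite /= in_itv/= s0 leNgt ns.
    rewrite memNset// mul0r sub0r normrN.
    rewrite (le_trans (ip_le _ Lu))// [leRHS]mulrAC ler_wpM2r//.
    apply: (@le_trans _ _ (expR (- (n%:R * d)) * nrm2 u * expR ((alpha0 + d) * s))); last first.
      by rewrite ler_wpM2r ?expR_ge0// lerDr.
    rewrite mulrAC ler_wpM2r// -expRD ler_expR.
    have : n%:R * d <= s * d by rewrite ler_wpM2r// ltW.
    lra.
  have ad : alpha0 + d < alpha by rewrite /d; lra.
  have := laplace_le gphi ad; rewrite -wE ger0_norm ?ip_ge0// -sqr_nrm2.
  rewrite (_ : alpha - (alpha0 + d) = d); last by rewrite /d; lra.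
  rewrite (_ : d * B n * nrm2 w / d = B n * nrm2 w); last by field; rewrite gt_eqF.
  have := nrm2_ge0 m w; rewrite le_eqVlt => /predU1P[<-//|w0].
  by rewrite expr2 ler_pM2r.
apply: (@squeeze_cvgr _ _ _ _ (fun=> 0) B).
- by apply: nearW => n; rewrite nrm2_ge0 le_B.
- exact: cvg_cst.
rewrite -(mul0r d^-1); apply: cvgMl.
rewrite -[X in _ --> X]addr0; apply: cvgD => //.
rewrite -(mul0r (nrm2 u)); apply: cvgMl.
apply: (@cvg_comp _ _ _ (fun n : nat => n%:R * d)
  (fun x => expR (- x)) _ (pinfty_nbhs R)); last exact: cvgr_expR.
apply/cvgryPge => A; near=> n; rewrite -ler_pdivrMr//.
by near: n; exact: nbhs_infty_ger.
Unshelve. all: by end_near. Qed.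

Variables (d : measure_display) (Omega : measurableType d).
Variables (X : \bar R -> Omega -> opc E) (P : opc E -> probability Omega R).
Hypothesis HA : associated m X P T.

(** The association of the process with the form, tested against indicators of
    sets of finite measure. *)
Lemma resolvent_integral alpha u A : 0 < alpha -> alpha0 < alpha -> bounded_borel u -> sqint u ->
  continuous (resolvent X P alpha u) ->
  measurable (A : set (borel E)) -> (m A < +oo)%E ->
  \int[m]_(x in A) resolvent X P alpha u x =
  laplace alpha (fun s => ip m (T s u) (\1_A : E -> R)).
Proof.
move=> a0 al bu Lu cR mA fA.
have LA := sqint_indic mA fA.
have [g1 [g2 [h1 h2 gE]]] := HA a0 bu.
have Lp : sqint (u^\+).
  apply: (sqint_le _ Lu); first by apply: measurable_funrpos; exact: sqint_meas Lu.
  by move=> x; rewrite ger0_norm ?funrpos_ge0// /funrpos ge_max ler_norm normr_ge0.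
have Ln : sqint (u^\-).
  apply: (sqint_le _ Lu); first by apply: measurable_funrneg; exact: sqint_meas Lu.
  by move=> x; rewrite ger0_norm ?funrneg_ge0// /funrneg ge_max -normrN ler_norm normr_ge0.
have [w1 Lw1 E1] := resolvent_ip al Lp.
have [w2 Lw2 E2] := resolvent_ip al Ln.
have gw1 := Linfty_resolvent_ge0_unique al Lp h1 Lw1 E1.
have gw2 := Linfty_resolvent_ge0_unique al Ln h2 Lw2 E2.
have -> : \int[m]_(x in A) resolvent X P alpha u x = ip m (w1 - w2) (\1_A : E -> R).
  rewrite ip_indic// /Rintegral; congr fine; apply: ae_eq_integral => //.
  - apply/measurable_EFinP; apply: measurable_funTS; exact: continuous_borel.
  - apply/measurable_EFinP; apply: measurable_funTS.
    exact: (sqint_meas (sqintB Lw1 Lw2)).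
  - near=> x => _ /=; congr EFin.
    have -> : resolvent X P alpha u x = (g1 - g2) x by near: x; exact: gE.
    rewrite !fctE; congr (_ - _); near: x; [exact: gw1|exact: gw2].
rewrite ipBl// E1// E2// -(laplaceB (ip_T_growth Lp LA) (ip_T_growth Ln LA) al).
apply: eq_laplace => s s0; rewrite -ip_T_sub//; congr (ip m (T s _) _).
exact: funrposBneg.
Unshelve. all: by end_near. Qed.

End semigroup.

(** * Images of compactly supported continuous functions *)
Section transition_strong_feller.
Context {R : realType} {E : pmetricType R}.
Variable m : {measure set (borel E) -> \bar R}.
Context {d : measure_display} {Omega : measurableType d}.
Variables (X : \bar R -> Omega -> opc E) (P : opc E -> probability Omega R).
Variables (F : set (E -> R)) (Ef : (E -> R) -> (E -> R) -> R) (alpha0 : R).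
Variable T : R -> (E -> R) -> E -> R.
Variable Ft : R -> set (set Omega).
Hypothesis E_lc : locally_compact [set: E].
Hypothesis E_sep : separable E.
Hypothesis m_radon : radon m.
Hypothesis m_full : full_support m.
Hypothesis alpha0_ge0 : 0 <= alpha0.
Hypothesis HT : semigroup_of_form m F Ef T alpha0.
Hypothesis HP : hunt_process_wrt X P Ft.
Hypothesis HA : associated m X P T.
Hypothesis RF : forall alpha : R, 0 < alpha -> strong_feller (resolvent X P alpha).
Hypothesis UC : forall t : R, 0 < t -> (opnorm2 m +oo (T t) < +oo)%E.
Hypothesis C0_dense : forall f, sqint m f -> forall e : R, 0 < e ->
  exists2 u, C0 u & nrm2 m (u - f) < e.

Local Notation Pt := (transition X P).

(** If h exceeded e at x, it would exceed some c > e on a relatively compact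
    neighbourhood A of x, which has positive finite measure, and its integral
    over A would be at least c m(A) > e m(A). The same applies to - h. *)
Lemma full_support_le (h : E -> R) e : continuous h -> 0 <= e ->
  (forall A : set E, open A -> (m A < +oo)%E -> m.-integrable (A : set (borel E)) (EFin \o h) ->
    `|\int[m]_(x in A) h x| <= e * fine (m A)) ->
  forall x, `|h x| <= e.
Proof.
move=> ch e0 hA x.
wlog suff hx : h ch hA / h x <= e.
  rewrite ler_norml hx// andbT lerNl; apply: (hx (fun y => - h y)).
    by move=> y; apply: cvgN; exact: ch.
  move=> A oA fA iA; have mA := open_borel oA.
  have iA' : m.-integrable (A : set (borel E)) (EFin \o h).
    have := integrable_EFinZ mA (-1) iA.
    by apply: eq_integrable => // y _ /=; rewrite mulN1r opprK.
  have -> : \int[m]_(y in A) (- h y) = - \int[m]_(y in A) h y.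
    rewrite -mulN1r -RintegralZl//.
    by apply: eq_Rintegral => y _; rewrite mulN1r.
  by rewrite normrN; exact: hA.
rewrite leNgt; apply/negP => ehx.
have [r r0 kr] := locally_compact_ball x E_lc.
pose c := (e + h x) / 2.
have ec : e < c by rewrite /c; lra.
have chx : c < h x by rewrite /c; lra.
(* The upper bound on h makes it integrable over A. *)
pose A := ball x r `&` [set y | c < h y] `&` [set y | h y < h x + 1].
have oA : open A.
  apply: openI; first apply: openI; first exact: metric_ball_open.
    by have /continuousP /(_ _ (@open_gt R c)) := ch.
  by have /continuousP /(_ _ (@open_lt R (h x + 1))) := ch.
have Ax : A x by split; [split => //; exact: ballxx|rewrite /= ltrDl].
have fA : (m A < +oo)%E.
  apply: (radon_lty m_radon (open_borel oA)); apply: (subclosed_compact _ kr).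
    exact: closed_closure.
  by apply: closureS => y [[]].
have mA := open_borel oA.
have mh : measurable_fun (A : set (borel E)) (h : borel E -> R).
  by apply: measurable_funTS; exact: continuous_borel.
have iA : m.-integrable (A : set (borel E)) (EFin \o h).
  have icst : m.-integrable (A : set (borel E)) (EFin \o cst (`|h x| + 1)).
    by apply: (integrable_bounded mA fA (C := `|h x| + 1)) => [|y];
      [exact: measurable_cst|rewrite ger0_norm ?addr_ge0].
  apply: (integrable_dominated mA mh icst) => y [[_ cy] /= yx].
  rewrite ger0_norm; first by rewrite (le_trans (ltW yx))// lerD2r ler_norm.
  by rewrite (le_trans e0)// (le_trans (ltW ec))// ltW.
have mA0 : 0 < fine (m A).
  by rewrite fine_gt0// fA andbT; apply: m_full => //; exists x.
have := hA A oA fA iA; apply/negP; rewrite -ltNge.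
apply: (@lt_le_trans _ _ (c * fine (m A))); first by rewrite ltr_pM2r.
rewrite (le_trans _ (ler_norm _))// -Rintegral_cst//.
apply: le_Rintegral => //.
- by apply: (integrable_bounded mA fA (C := `|c|)) => //; exact: measurable_cst.
- by move=> y [[_ cy] _]; exact: ltW.
Qed.

Lemma transition_growth u : C0 u ->
  exists M, forall x, exp_growth alpha0 M (fun s => Pt s u x).
Proof.
move=> u0; have [M M0 uM] := C0_bounded u0; exists M => x; split.
  apply: right_continuous_measurable => s s0.
  exact: (transition_right_continuous HP).
move=> s s0; rewrite (le_trans (transition_le HP s0 (C0_borel u0) M0 uM x))//.
by rewrite ler_peMr// -expR0 ler_expR mulr_ge0.
Qed.

Lemma resolvent_transitionE b t u x : 0 <= t -> C0 u ->
  resolvent X P b (Pt t u) x = laplace b (fun s => Pt (s + t) u x).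
Proof.
move=> t0 u0; apply: (@eq_laplace R b (fun s => Pt s (Pt t u) x)) => s s0.
by rewrite (transition_markov HP)//; exact: C0_borel.
Qed.

(** Association only gives the resolvents of u, that is, the Laplace transforms
    of s |-> P_s u; those of s |-> P_(s + t) u follow by Phragmen's inversion. *)
Lemma resolvent_transition_integral b t u (A : set (borel E)) : alpha0 < b ->
  0 <= t -> C0 u -> measurable A -> (m A < +oo)%E ->
  \int[m]_(x in A) resolvent X P b (Pt t u) x =
  laplace b (fun s => ip m (T (s + t) u) (\1_A : E -> R)).
Proof.
move=> ab t0 u0 mA fA.
have Lu := C0_sqint m_radon u0; have LA := sqint_indic mA fA.
have [M gM] := transition_growth u0.
under eq_Rintegral do rewrite resolvent_transitionE//.
have b0 c : b <= c -> 0 < c by move=> bc; exact/(lt_le_trans _ bc)/(le_lt_trans alpha0_ge0).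
have cR c : b <= c -> continuous (resolvent X P c u).
  by move=> /b0 c0; have [] := RF c0 (C0_borel u0).
apply: (laplace_tail_integral mA fA t0 ab gM (ip_T_growth HT Lu LA)) => c bc.
  exact: continuous_borel (cR c bc).
apply: (resolvent_integral HT HA) => //; [exact: b0|exact: lt_le_trans bc|exact: C0_borel|exact: cR].
Qed.

(** Here ultracontractivity enters: it bounds (T_t (T_s u - u), 1_A) by
    C |T_s u - u| m(A), a modulus of continuity proportional to m(A). *)
Lemma resolvent_transition_near t u e : 0 < t -> C0 u -> 0 < e ->
  exists2 B, alpha0 < B & forall b (A : set (borel E)), B <= b ->
    measurable A -> (m A < +oo)%E ->
    `|\int[m]_(x in A) (b * resolvent X P b (Pt t u) x) -
      ip m (T t u) (\1_A : E -> R)| <= e * fine (m A).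
Proof.
move=> t0 u0 e0; have Lu := C0_sqint m_radon u0.
set C := fine (opnorm2 m +oo (T t)).
have C_ge0 : 0 <= C by rewrite fine_ge0// opnorm2_ge0.
(* Abel's bound will be (e' C + 4 K C / b) m(A), where K is the constant of
   growth_modulus for e'; both terms have to be at most e / 2. *)
pose e' := e / (2 * (C + 1)).
have e'0 : 0 < e' by rewrite divr_gt0// mulr_gt0// ltr_wpDl.
have N0 := nrm2_ge0 m u.
have [|s s0|dd d0|K K0 hK] := @growth_modulus R alpha0 (nrm2 m u + nrm2 m u)
  (fun s => nrm2 m (T s u - u)) e' alpha0_ge0 _ e'0.
- exact: addr_ge0.
- have LT := T_sqint HT s0 Lu.
  have := nrm2D LT (sqintZ (-1) Lu); rewrite scaleN1r => /le_trans; apply.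
  have -> : nrm2 m (- u) = nrm2 m u by rewrite -scaleN1r nrm2Z// normrN normr1 mul1r.
  rewrite mulrDl lerD//; first by rewrite mulrC; exact: (T_norm HT).
  by rewrite ler_peMr// -expR0 ler_expR mulr_ge0.
- exact: (T_continuous0 HT).
exists (2 * (alpha0 + 1) + 8 * K * (C + 1) / e) => [|b A bB mA fA].
  have : 0 <= 8 * K * (C + 1) / e by rewrite divr_ge0 ?(ltW e0)// !mulr_ge0// addr_ge0.
  have := alpha0_ge0; lra.
have Ke : 0 <= 8 * K * (C + 1) / e by rewrite divr_ge0 ?(ltW e0)// !mulr_ge0// addr_ge0.
have b0 : 0 < b by apply: lt_le_trans bB; rewrite ltr_wpDr// mulr_gt0// ltr_wpDl.
have ab : alpha0 < b by apply: lt_le_trans bB; have := alpha0_ge0; lra.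
have LA := sqint_indic mA fA.
have mA0 : 0 <= fine (m A) by exact: fine_ge0.
have bP := transition_bounded_borel HP (ltW t0) (C0_borel u0).
have [cR bR] := RF b0 bP.
have [M M0 hM] := (bounded_onP _).1 bR.
rewrite RintegralZl//; last first.
  apply: (integrable_bounded mA fA (C := M)) => //.
  by apply: measurable_funTS; exact: continuous_borel.
rewrite resolvent_transition_integral//; last exact: ltW.
have gT := exp_growth_shift (ip_T_growth HT Lu LA) (ltW t0).
apply: (@le_trans _ _ (e' * (C * fine (m A)) + 4 * (K * (C * fine (m A))) / b)).
  apply: (abel_bound gT alpha0_ge0) => [|||].
  - by rewrite !mulr_ge0.
  - exact: mulr_ge0 (ltW e'0) (mulr_ge0 C_ge0 mA0).
  - move=> s s0.
    have LTs := T_sqint HT s0 Lu.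
    have -> : ip m (T (s + t) u) (\1_A : E -> R) = ip m (T t (T s u)) (\1_A : E -> R).
      apply: ip_aeql => //.
      - by apply: (T_sqint HT) => //; exact/addr_ge0/ltW.
      - by apply: (T_sqint HT) => //; exact: ltW.
      by rewrite addrC; apply: (sg_D HT) => //; exact: ltW.
    rewrite -(ip_T_sub HT (ltW t0))//.
    have LB : sqint m (T s u - u) by exact: sqintB.
    apply: le_trans (opnorm2oo_le _ _ (UC t0) LB mA fA) _.
    + by move=> f Lf; apply: (T_sqint HT) => //; exact: ltW.
    + by move=> a f g Lf Lg; apply: (sg_lin HT) => //; exact: ltW.
    rewrite -/C (le_trans (ler_wpM2r (mulr_ge0 C_ge0 mA0) (hK s s0)))//.
    by rewrite mulrDl [X in _ + X]mulrAC -mulrA.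
  - by apply: le_trans bB; rewrite lerDl.
have -> : e' * (C * fine (m A)) + 4 * (K * (C * fine (m A))) / b =
    (e' * C + 4 * K * C / b) * fine (m A) by ring.
rewrite ler_wpM2r//.
have h1 : e' * C <= e / 2.
  rewrite /e' mulrAC ler_pdivrMr ?mulr_gt0 ?ltr_wpDl//.
  by have := mulr_ge0 (ltW e0) C_ge0; nra.
have h2 : 4 * K * C / b <= e / 2.
  rewrite ler_pdivrMr//.
  have : 8 * K * (C + 1) / e <= b by apply: le_trans bB; rewrite lerDr mulr_ge0// addr_ge0.
  rewrite ler_pdivrMr// => h; nra.
by rewrite [leRHS]splitr lerD.
Qed.

(** The functions b R_b (P_t u) are continuous and uniformly close to each other
    for large b, because their integrals over any A are close to the same number
    (T_t u, 1_A). Abel's theorem identifies their pointwise limit as P_t u. *)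
Lemma transition_C0 t u : 0 < t -> C0 u -> continuous (Pt t u) /\
  forall x, `|Pt t u x| <= nrm2 m u * fine (opnorm2 m +oo (T t)).
Proof.
move=> t0 u0; have Lu := C0_sqint m_radon u0.
set C := fine (opnorm2 m +oo (T t)).
have bP := transition_bounded_borel HP (ltW t0) (C0_borel u0).
pose h b x := b * resolvent X P b (Pt t u) x.
have ch b : alpha0 < b -> continuous (h b).
  move=> ab x; have b0 : 0 < b := le_lt_trans alpha0_ge0 ab.
  by apply: cvgM; [exact: cvg_cst|exact: (RF b0 bP).1].
have abel e x : 0 < e -> exists B, forall b, B <= b -> `|h b x - Pt t u x| <= e.
  move=> e0; have [M gM] := transition_growth u0.
  have gMt := exp_growth_shift (gM x) (ltW t0).
  have [|B hB] := abel_cvg gMt alpha0_ge0 e0.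
    rewrite add0r; apply/cvg_at_rightP => v [v0 cv].
    have /cvg_at_rightP := transition_right_continuous HP (x := x) (ltW t0) u0.
    apply; split => [n|]; first by rewrite ltrDr.
    by rewrite -[X in _ --> X]add0r; apply: cvgD => //; exact: cvg_cst.
  exists B => b /hB; rewrite add0r /h resolvent_transitionE//; exact: ltW.
have unif e : 0 < e -> exists2 B, alpha0 < B & forall b, B <= b -> forall x, `|h b x - Pt t u x| <= e.
  move=> e0; have e30 : 0 < e / 3 by rewrite divr_gt0.
  have [B aB hB] := resolvent_transition_near t0 u0 e30.
  exists B => // b bB x.
  have [B' hB'] := abel (e / 3) x e30.
  (* The pointwise threshold B' depends on x; comparing at c, beyond both
   thresholds, transfers the estimate to every b >= B. *)
pose c := Num.max B B'.
  have Bc : B <= c by rewrite le_max lexx.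
  have B'c : B' <= c by rewrite le_max lexx orbT.
  have ab := lt_le_trans aB bB; have ac := lt_le_trans aB Bc.
  have hbc : `|h b x - h c x| <= e / 3 + e / 3.
    apply: (@full_support_le (fun x => h b x - h c x)) => [y||A oA fA iA].
    - by apply: cvgB; exact: ch.
    - by rewrite addr_ge0// ltW.
    have mA := open_borel oA.
    have ih k : alpha0 < k -> m.-integrable (A : set (borel E)) (EFin \o h k).
      move=> ak; have k0 : 0 < k := le_lt_trans alpha0_ge0 ak.
      have [cR /bounded_onP [M M0 hM]] := RF k0 bP.
      apply: (integrable_bounded mA fA (C := `|k| * M)).
        by apply: measurable_funTS; apply: continuous_borel; exact: ch.
      by move=> y; rewrite normrM ler_wpM2l.
    rewrite RintegralB//; [|exact: ih|exact: ih].
    have hb := hB b A bB mA fA; have hc := hB c A Bc mA fA.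
    apply: (le_trans (ler_distD (ip m (T t u) (\1_A : E -> R)) _ _)).
    by rewrite mulrDl; apply: (lerD hb); rewrite distrC; exact: hc.
  rewrite -(subrKA (h c x)) (le_trans (ler_normD _ _))//.
  have := hB' c B'c; lra.
split.
  move=> x; apply/cvgrPdist_le => e e0; have e30 : 0 < e / 3 by rewrite divr_gt0.
  have [B aB hB] := unif _ e30.
  have := ch B aB x => /cvgrPdist_le /(_ _ e30); apply: filterS => y hy.
  have h1 := hB B (lexx B) x; have h2 := hB B (lexx B) y.
  move: h1 h2 hy; rewrite !ler_norml; move=> /andP[? ?] /andP[? ?] /andP[? ?].
  by apply/andP; split; lra.
move=> x; apply/ler_addgt0Pr => e e0; have e20 : 0 < e / 2 by rewrite divr_gt0.
have [B1 aB1 hB1] := unif _ e20.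
have [B2 aB2 hB2] := resolvent_transition_near t0 u0 e20.
pose b := Num.max B1 B2.
have bB1 : B1 <= b by rewrite le_max lexx.
have bB2 : B2 <= b by rewrite le_max lexx orbT.
have C_ge0 : 0 <= C by rewrite fine_ge0// opnorm2_ge0.
have N0 := nrm2_ge0 m u.
have hb : `|h b x| <= nrm2 m u * C + e / 2.
  apply: full_support_le => [||A oA fA iA].
  - by apply: ch; exact: lt_le_trans bB1.
  - by rewrite addr_ge0// ?mulr_ge0// ltW.
  have mA := open_borel oA.
  have := hB2 b A bB2 mA fA => h2.
  have h3 : `|ip m (T t u) (\1_A : E -> R)| <= nrm2 m u * (C * fine (m A)).
    apply: (@opnorm2oo_le _ _ m (T t)) => //.
    + by move=> f Lf; apply: (T_sqint HT) => //; exact: ltW.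
    + by move=> a f g Lf Lg; apply: (sg_lin HT) => //; exact: ltW.
    + exact: UC.
  rewrite -(subrK (ip m (T t u) (\1_A : E -> R)) (\int[m]_(y in A) h b y)).
  rewrite (le_trans (ler_normD _ _))// mulrDl addrC lerD// -mulrA//.
rewrite -(subrK (h b x) (Pt t u x)) (le_trans (ler_normD _ _))//.
have := hB1 b bB1 x; rewrite distrC; lra.
Qed.

(** * From compactly supported continuous to bounded Borel functions *)
Section fixed_time.
Variables (t : R) (t0 : 0 < t).
Local Notation C := (fine (opnorm2 m +oo (T t))).
Let tge0 : 0 <= t := ltW t0.
Let C_ge0 : 0 <= C. Proof. by rewrite fine_ge0// opnorm2_ge0. Qed.

(** The functions to which the bound |P_t u| <= C |u| on C0 extends by L2
    approximation. Comparing f with all u in C0, rather than requiring only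
    |P_t f| <= C |f|, makes the class stable under the operations below without
    speaking of classes modulo null sets. *)
Definition controlled (f : E -> R) : Prop :=
  [/\ bounded_borel f, sqint m f &
    forall u x, C0 u -> `|Pt t u x - Pt t f x| <= nrm2 m (u - f) * C].

Lemma transitionB f g x : bounded_borel f -> bounded_borel g ->
  Pt t (f - g) x = Pt t f x - Pt t g x.
Proof.
move=> bf bg; rewrite addrC -scaleN1r (transition_lin HP (-1) x tge0 bg bf).
by rewrite mulN1r addrC.
Qed.

Lemma controlled_C0 u : C0 u -> controlled u.
Proof.
move=> u0; split; [exact: C0_borel|exact: C0_sqint|move=> v x v0].
rewrite -transitionB; [|exact: C0_borel|exact: C0_borel].
by have [_] := transition_C0 t0 (C0B v0 u0); apply.
Qed.

(** Given u near a f + g, approximate f by v in C0 and compare g with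
    u - a v. *)
Lemma controlled_lin a f g : controlled f -> controlled g -> controlled (a *: f + g).
Proof.
move=> [bf Lf cf] [bg Lg cg]; split; [exact: bounded_borel_lin|exact: sqint_lin|].
move=> u x u0; apply/ler_addgt0Pr => e e0.
pose e1 := e / (2 * (`|a| * C + 1)).
have e10 : 0 < e1 by rewrite divr_gt0// mulr_gt0// ltr_wpDl// mulr_ge0.
have [v v0 vf] := C0_dense Lf e10.
pose w : E -> R := (- a) *: v + u.
have w0 : C0 w by exact: C0_lin.
have [bu bv bw] := And3 (C0_borel u0) (C0_borel v0) (C0_borel w0).
have Pw : Pt t w x = - a * Pt t v x + Pt t u x by exact: (transition_lin HP).
rewrite (transition_lin HP a x tge0 bf bg).
rewrite (_ : _ - _ = a * (Pt t v x - Pt t f x) + (Pt t w x - Pt t g x)); last first.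
  by rewrite Pw; ring.
have hv := cf v x v0; have hw := cg w x w0.
have Lu := C0_sqint m_radon u0; have Lv := C0_sqint m_radon v0.
have wg : w - g = (- a) *: (v - f) + (u - (a *: f + g)).
  by apply/funext => y; rewrite /w !fctE /GRing.scale/=; ring.
have Nw : nrm2 m (w - g) <= `|a| * nrm2 m (v - f) + nrm2 m (u - (a *: f + g)).
  rewrite wg (le_trans (nrm2D _ _))//.
  - exact/sqintZ/sqintB.
  - by apply: sqintB => //; exact: sqint_lin.
  by rewrite nrm2Z ?normrN//; exact: sqintB.
rewrite (le_trans (ler_normD _ _))// normrM.
have aC0 : 0 <= `|a| * C by exact: mulr_ge0.
have h1 : `|a| * `|Pt t v x - Pt t f x| <= `|a| * C * e1.
  rewrite -mulrA ler_wpM2l// (le_trans hv)// mulrC ler_wpM2l// ltW//.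
have h2 : nrm2 m (w - g) * C <= nrm2 m (u - (a *: f + g)) * C + `|a| * C * e1.
  rewrite (le_trans (ler_wpM2r C_ge0 Nw))// mulrDl addrC lerD2l mulrAC.
  by rewrite ler_wpM2l// ltW.
have h3 : `|a| * C * e1 <= e / 2.
  by rewrite /e1 mulrA ler_pdivrMr ?mulr_gt0 ?ltr_wpDl//; nra.
lra.
Qed.

Lemma controlled_cvg (f_ : nat -> E -> R) f v M :
  (forall n, controlled (f_ n)) -> sqint m v -> 0 <= M ->
  (forall n x, `|f_ n x| <= M) -> (forall n x, `|f_ n x| <= `|v x|) ->
  (forall x, f_ n x @[n --> \oo] --> f x) -> controlled f.
Proof.
move=> cf_ Lv M0 fM fv f_f.
have mf_ n : measurable_fun [set: borel E] (f_ n : borel E -> R) by have [[]] := cf_ n.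
have mf : measurable_fun [set: borel E] (f : borel E -> R).
  by apply: (measurable_fun_cvg mf_) => x _; exact: f_f.
have lim_le c x : (forall n, `|f_ n x| <= c) -> `|f x| <= c.
  move=> h; apply: (@cvgn_le _ (fun n => `|f_ n x|)) => //.
  exact: cvg_norm (f_f x).
have bf : bounded_borel f.
  by split => //; apply/bounded_onP; exists M => // x; apply: lim_le.
have Lf : sqint m f by apply: (sqint_le mf Lv) => x; apply: lim_le.
split => // u x u0.
have Lu := C0_sqint m_radon u0.
have Lf_ n : sqint m (f_ n) by have [] := cf_ n.
have Nf := nrm2_dominated_cvg mf_ Lf Lv f_f fv.
have Pf := transition_cvg HP (x := x) tge0 mf_ M0 fM f_f.
have h1 : Pt t u x - Pt t (f_ n) x @[n --> \oo] --> Pt t u x - Pt t f x.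
  by apply: cvgB => //; exact: cvg_cst.
have h2 : `|Pt t u x - Pt t (f_ n) x| @[n --> \oo] --> `|Pt t u x - Pt t f x|.
  exact: cvg_norm h1.
have h3 : (nrm2 m (u - f) + nrm2 m (f_ n - f)) * C @[n --> \oo] -->
    nrm2 m (u - f) * C.
  rewrite -[X in _ --> X * C]addr0; apply: cvgMl.
  by apply: cvgD => //; exact: cvg_cst.
apply: (ler_cvg_to h2 h3).
apply: nearW => n; have [_ _ h] := cf_ n.
rewrite (le_trans (h u x u0))// ler_wpM2r//.
rewrite (_ : u - f_ n = (u - f) + (f - f_ n)); last first.
  by apply/funext => y; rewrite !fctE; ring.
by rewrite (nrm2B m (f_ n) f); apply: nrm2D; exact: sqintB.
Qed.

Lemma controlled_continuous f : controlled f -> continuous (Pt t f).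
Proof.
move=> [bf Lf cf] x; apply/cvgrPdist_le => e e0.
pose e1 := e / (3 * (C + 1)).
have e10 : 0 < e1 by rewrite divr_gt0// mulr_gt0// ltr_wpDl.
have [u u0 uf] := C0_dense Lf e10.
have [cu _] := transition_C0 t0 u0.
have near_uf y : `|Pt t u y - Pt t f y| <= e / 3.
  rewrite (le_trans (cf u y u0))// (le_trans (ler_wpM2r C_ge0 (ltW uf)))//.
  by rewrite /e1 mulrAC ler_pdivrMr ?mulr_gt0 ?ltr_wpDl//; nra.
have e30 : 0 < e / 3 by rewrite divr_gt0.
have := cu x => /cvgrPdist_le /(_ _ e30); apply: filterS => y hy.
have h1 := near_uf x; have h2 := near_uf y.
move: h1 h2 hy; rewrite !ler_norml; move=> /andP[? ?] /andP[? ?] /andP[? ?].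
by apply/andP; split; lra.
Qed.

(** Dynkin's theorem: the open sets form a pi-system, for which Urysohn
    functions provide dominated approximations, and the sets B with controlled
    indicator of the intersection with V form a lambda-system, 1_V being a
    square-integrable function that dominates all of these indicators. *)
Lemma controlled_indic (V : set E) (B : set (borel E)) : open V ->
  compact (closure V) -> measurable B -> controlled (\1_(B `&` V)).
Proof.
move=> oV kV mB.
have mV := open_borel oV.
have fV := radon_lty m_radon mV kV.
have LV := sqint_indic mV fV.
have leV (A : set E) x : `|\1_(A `&` V) x : R| <= `|\1_V x : R|.
  rewrite !indicE !ger0_norm// ler_nat in_setI; by case: (x \in A).
pose H := [set B : set (borel E) | measurable B /\ controlled (\1_(B `&` V))].
have openH U : open U -> controlled (\1_(U `&` V)).
  move=> oU; have oUV : open (U `&` V) by exact: openI.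
  have kUV : compact (closure (U `&` V)).
    apply: (subclosed_compact _ kV); first exact: closed_closure.
    by apply: closureS; exact: subIsetr.
  have [phi [phi0 phi1 phic]] := open_indic_approx oUV kUV.
  have phi_le n x : `|phi n x| <= `|\1_(U `&` V) x : R|.
    by have /andP[h1 h2] := phi1 n x; rewrite ger0_norm// (le_trans h2)// ler_norm.
  apply: (@controlled_cvg phi _ (\1_V) 1) => //.
  - by move=> n; exact: controlled_C0.
  - by move=> n x; exact: le_trans (phi_le n x) (indic_norm_le1 _ _).
  - by move=> n x; exact: le_trans (phi_le n x) (leV _ _).
suff : (<<s setT, (@open E : set (set (borel E))) >>) `<=` H by move=> /(_ B mB) [].
apply: lambda_system_subset => //.
- by move=> A A' oA oA'; exact: openI.
- split => //.
  + by split; [exact: measurableT|apply: openH; exact: openT].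
  + move=> A A' A'A [mA cA] [mA' cA']; split; first exact: measurableD.
    rewrite (_ : \1_(_) = (-1 : R) *: \1_(A' `&` V) + \1_(A `&` V)).
      exact: controlled_lin.
    apply/funext => x; rewrite !fctE /GRing.scale/= setDE !indicE !in_setI in_setC.
    have : (x \in A') ==> (x \in A) by apply/implyP; rewrite !inE; exact: A'A.
    case: (x \in A); case: (x \in A') => //= _; case: (x \in V) => /=; ring.
  + move=> A ndA hA; split; first by apply: bigcupT_measurable => n; have [] := hA n.
    apply: (@controlled_cvg (fun n => \1_(A n `&` V)) _ (\1_V) 1) => //.
    - by move=> n; have [] := hA n.
    - by move=> n x; exact: indic_norm_le1.
    move=> x; apply: cvg_near_cst.
    have [[n _ Anx]|nA] := pselect ((\bigcup_k A k) x).
      near=> k; rewrite !indicE !in_setI; congr ((_ && _)%:R).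
      have Akx : A k x.
        have /subsetPset : (A n <= A k)%O by apply: ndA; near: k; exact: nbhs_infty_ge.
        exact.
      by rewrite !mem_set//; exists n.
    apply: nearW => k; rewrite !indicE !in_setI; congr ((_ && _)%:R).
    by rewrite !memNset// => Akx; apply: nA; exists k.
- by move=> U oU; split; [exact: open_borel|exact: openH].
Unshelve. all: by end_near. Qed.

Lemma controlled_sum n (c : nat -> R) (g : nat -> E -> R) :
  (forall i, controlled (g i)) -> controlled (fun x => \sum_(i < n) c i * g i x).
Proof.
move=> cg; elim: n => [|n IH].
  rewrite (_ : (fun x => _) = (-1 : R) *: g 0%N + g 0%N); first exact: controlled_lin.
  by apply/funext => x; rewrite big_ord0 !fctE /GRing.scale/= mulN1r addNr.
rewrite (_ : (fun x => _) = c n *: g n + (fun x => \sum_(i < n) c i * g i x)).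
  exact: controlled_lin.
by apply/funext => x; rewrite big_ord_recr /= addrC !fctE.
Qed.

Import HBNNSimple.

(** Approximation from below by simple functions, dominated by M 1_V. *)
Lemma controlled_borel (V : set E) f : open V -> compact (closure V) ->
  (forall x, 0 <= f x) -> bounded_borel f -> controlled (fun x => f x * \1_V x).
Proof.
move=> oV kV f0 [mf /bounded_onP [M M0 fM]].
have mEf : measurable_fun [set: borel E] (EFin \o (f : borel E -> R)) by exact/measurable_EFinP.
pose g := nnsfun_approx measurableT mEf.
have gf (x : borel E) : g n x @[n --> \oo] --> f x.
  have := @cvg_nnsfun_approx _ _ _ _ measurableT _ mEf (fun x _ => f0 x) x I.
  by move=> /fine_cvgP[_].
have g_le n (x : borel E) : g n x <= f x.
  rewrite -(cvg_lim _ (gf x))//; apply: nondecreasing_cvgn_le; last exact: (cvgP _ (gf x)).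
  by move=> i j ij; exact/lefP/nd_nnsfun_approx.
have cg n : controlled (fun x : E => g n x * \1_V x).
  pose s := fset_set (range (g n)).
  pose B i : set (borel E) := g n @^-1` [set (finmap.enum_fset s)`_i].
  have mB i : measurable (B i) by exact: measurable_funPTI.
  rewrite (_ : (fun x : E => _) = (fun x : E =>
      \sum_(i < size (finmap.enum_fset s)) (finmap.enum_fset s)`_i * (\1_(B i `&` V) x : R))).
    apply: (@controlled_sum _ (fun i => (finmap.enum_fset s)`_i)
      (fun i => \1_(B i `&` V) : E -> R)) => i.
    exact: controlled_indic.
  apply/funext => x; rewrite fimfunEord mulr_suml; apply: eq_bigr => i _.
  by rewrite -mulrA !indicE in_setI -natrM mulnb.
have oneV x : 0 <= (\1_V x : R) <= 1.
  by rewrite indicE; case: (_ \in _); rewrite ?lexx ?ler01.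
have mV := open_borel oV.
have fV := radon_lty m_radon mV kV.
have g_abs n x : `|g n x * \1_V x| <= `|(M *: (\1_V : E -> R)) x|.
  have /andP[h1 _] := oneV x.
  rewrite fctE /GRing.scale/= !normrM ler_wpM2r// !ger0_norm//.
  by rewrite (le_trans (g_le n x))// (le_trans (ler_norm _)).
apply: (@controlled_cvg (fun n x => g n x * \1_V x) _ (M *: \1_V) M) => //.
- exact/sqintZ/sqint_indic.
- move=> n x; rewrite (le_trans (g_abs n x))// fctE /GRing.scale/= normrM.
  have /andP[h1 h2] := oneV x.
  by rewrite !ger0_norm// ler_piMr.
- by move=> x; apply: cvgMl; exact: gf.
Qed.

End fixed_time.

(** Truncation to an exhaustion makes P_t g an increasing limit of continuous
    functions, hence lower semicontinuous, for every bounded Borel g >= 0. *)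
Lemma transition_continuous t f : 0 < t ->
  continuous (Pt t (cst 1)) -> bounded_borel f -> continuous (Pt t f).
Proof.
move=> t0 c1 bf.
have [V [oV kV V_le Vcov]] := open_exhaustion E_lc E_sep.
have lsc g : (forall x, 0 <= g x) -> bounded_borel g ->
  forall x c, c < Pt t g x -> \forall y \near x, c < Pt t g y.
  move=> g0 bg x c cx; have [mg /bounded_onP [M M0 gM]] := bg.
  pose gV n y := g y * \1_(V n) y.
  have gV_le n y : `|gV n y| <= M.
    by rewrite /gV normrM (le_trans _ (gM y))// ler_piMr// indic_norm_le1.
  have mgV n : measurable_fun [set: borel E] (gV n : borel E -> R).
    by apply: measurable_funM => //; apply: measurable_indic; exact: open_borel.
  have bgV n : bounded_borel (gV n) by split => //; apply/bounded_onP; exists M.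
  have gVg y : gV n y @[n --> \oo] --> g y.
    apply: cvg_near_cst; have [k Vk] := Vcov y; near=> n.
    rewrite /gV indicE mem_set ?mulr1//; apply: (V_le k) => //.
    by near: n; exact: nbhs_infty_ge.
  have gVP := transition_cvg HP (x := x) (ltW t0) mgV M0 gV_le gVg.
  have [n cn] : exists n, c < Pt t (gV n) x.
    have [n _ /(_ n (leqnn n)) cn] := cvgr_gt _ gVP _ cx.
    by exists n.
  have cgV : continuous (Pt t (gV n)).
    exact/(controlled_continuous t0)/controlled_borel.
  have h : \forall y \near x, c < Pt t (gV n) y by exact: (cvgr_gt _ (cgV x) _ cn).
  move: h; apply: filterS => y /lt_le_trans; apply.
  rewrite -subr_ge0 -(transitionB t0)//; apply: transition_ge0 => z.
  by rewrite !fctE /gV subr_ge0 ler_piMr// indicE; case: (_ \in _); rewrite ?lexx ?ler01.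
have [mf /bounded_onP [M M0 fM]] := bf.
have b1 : bounded_borel (cst 1 : E -> R).
  split; first exact: measurable_cst.
  by apply/bounded_onP; exists 1 => // x; rewrite normr1.
have PM y : Pt t (M *: (cst 1 : E -> R) + f) y = M * Pt t (cst 1) y + Pt t f y.
  by rewrite (transition_lin HP _ _ (ltW t0)).
have PN y : Pt t (- f) y = - Pt t f y.
  rewrite (_ : - f = (- 2 : R) *: f + f); last first.
    by apply/funext => z; rewrite !fctE /GRing.scale/=; ring.
  by rewrite (transition_lin HP _ _ (ltW t0))//; ring.
have b0 : bounded_borel (M *: (cst 1 : E -> R) + f) by exact: bounded_borel_lin.
have bN : bounded_borel (- f).
  split; first exact: measurableT_comp.
  by apply/bounded_onP; exists M => // x; rewrite fctE normrN.
have b2 : bounded_borel (M *: (cst 1 : E -> R) - f) by exact: bounded_borel_lin.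
have PB y : Pt t (M *: (cst 1 : E -> R) - f) y = M * Pt t (cst 1) y - Pt t f y.
  by rewrite (transition_lin HP _ _ (ltW t0))// PN.
have ge0 g y : (forall z, `|g z| <= M) -> 0 <= (M *: (cst 1 : E -> R) + g) y.
  move=> gM; rewrite !fctE /GRing.scale/= mulr1 addrC -lerBlDr sub0r.
  by have := gM y; rewrite ler_norml => /andP[].
move=> x; apply/cvgrPdist_lt => e e0.
have e20 : 0 < e / 2 by rewrite divr_gt0.
have P1 : \forall y \near x, `|M * Pt t (cst 1) x - M * Pt t (cst 1) y| < e / 2.
  suff : M * Pt t (cst 1) y @[y --> x] --> M * Pt t (cst 1) x.
    by move=> /cvgrPdist_lt; exact.
  by apply: cvgM; [exact: cvg_cst|exact: c1].
have P2 : \forall y \near x, Pt t (M *: (cst 1 : E -> R) + f) x - e / 2 < Pt t (M *: (cst 1 : E -> R) + f) y.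
  apply: lsc => //; first by move=> z; exact: ge0.
  by rewrite gtrBl.
have P3 : \forall y \near x, Pt t (M *: (cst 1 : E -> R) - f) x - e / 2 < Pt t (M *: (cst 1 : E -> R) - f) y.
  apply: lsc => //; first by move=> z; apply: ge0 => w; rewrite fctE normrN.
  by rewrite gtrBl.
near=> y.
have h1 : `|M * Pt t (cst 1) x - M * Pt t (cst 1) y| < e / 2 by near: y.
have h2 : Pt t (M *: (cst 1 : E -> R) + f) x - e / 2 < Pt t (M *: (cst 1 : E -> R) + f) y by near: y.
have h3 : Pt t (M *: (cst 1 : E -> R) - f) x - e / 2 < Pt t (M *: (cst 1 : E -> R) - f) y by near: y.
move: h1 h2 h3; rewrite !PM !PB !ltr_norml => /andP[? ?] ? ?.
by apply/andP; split; lra.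
Unshelve. all: by end_near. Qed.

(** When m(E) is finite, 1 is square integrable, hence itself a dominated limit
    of indicators of relatively compact open sets. *)
Lemma transition1_continuous t : 0 < t -> (m setT < +oo)%E ->
  continuous (Pt t (cst 1)).
Proof.
move=> t0 fE; apply: (controlled_continuous t0).
have [V [oV kV V_le Vcov]] := open_exhaustion E_lc E_sep.
have le1 n x : `|\1_(V n) x : R| <= 1 := indic_norm_le1 (V n) x.
apply: (@controlled_cvg _ t0 (fun n => \1_(V n)) _ (cst 1) 1) => //.
- by move=> n; rewrite -[V n]setTI; apply: controlled_indic.
- rewrite -[cst 1]indicT. exact: sqint_indic.
- by move=> n x; rewrite normr1.
move=> x; apply: cvg_near_cst; have [k Vk] := Vcov x; near=> n.
rewrite indicE mem_set//; apply: (V_le k) => //.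
by near: n; exact: nbhs_infty_ge.
Unshelve. all: by end_near. Qed.

End transition_strong_feller.

(** The form domain is dense in L2, and its intersection with C0 is dense in it
    for a norm that dominates the L2 norm: since form_shift alpha0 is
    nonnegative, form_shift (alpha0 + 1) u u is at least the squared norm of
    u. *)
Lemma C0_L2_dense (R : realType) (E : pmetricType R)
    (m : {measure set (borel E) -> \bar R})
    (F : set (E -> R)) (Ef : (E -> R) -> (E -> R) -> R) (alpha0 : R) f e :
  lower_bounded_semi_dirichlet m F Ef alpha0 -> regular_form m F Ef alpha0 ->
  sqint m f -> 0 < e -> exists2 u, C0 u & nrm2 m (u - f) < e.
Proof.
move=> HE [HR _] Lf e0; have e20 : 0 < e / 2 by rewrite divr_gt0.
have [u Fu uf] := form_dense HE Lf e20.
have [v [Fv v0] uv] := HR u Fu _ e20.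
have Lu : sqint m u := form_L2 HE Fu; have Lv : sqint m v := form_L2 HE Fv.
have Fuv : F (u - v) by rewrite addrC -scaleN1r; exact: (form_dom HE).
exists v => //.
have h1 : nrm2 m (u - f) < e / 2.
  by rewrite nrm2B -lte_fin -Lpnorm2E//; exact: sqintB.
have h2 : nrm2 m (v - u) <= form_norm m Ef (alpha0 + 1) (u - v).
  rewrite nrm2B /form_norm /nrm2 ler_wsqrtr// -[leLHS]add0r.
  by rewrite /form_shift mulrDl mul1r addrA lerD2r; exact: (form_lower HE Fuv).
rewrite -(subrKA u) (splitr e) addrC.
rewrite (le_lt_trans (nrm2D _ _)) ?ltrD//; [exact: sqintB|exact: sqintB|].
exact: le_lt_trans uv.
Qed.

Theorem theorem4 (R : realType) (E : pmetricType R)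
    (m : {measure set (borel E) -> \bar R})
    (d : measure_display) (Omega : measurableType d)
    (X : \bar R -> Omega -> opc E) (P : opc E -> probability Omega R)
    (F : set (E -> R)) (Ef : (E -> R) -> (E -> R) -> R) (alpha0 : R)
    (T : R -> (E -> R) -> E -> R) :
  locally_compact [set: E] ->
  separable E ->
  radon m ->
  full_support m ->
  lower_bounded_semi_dirichlet m F Ef alpha0 ->
  regular_form m F Ef alpha0 ->
  semigroup_of_form m F Ef T alpha0 ->
  hunt_process X P ->
  associated m X P T ->
  (forall alpha : R, 0 < alpha -> strong_feller (resolvent X P alpha)) ->
  (forall t : R, 0 < t -> (opnorm2 m +oo (T t) < +oo)%E) ->
  (m [set: E] < +oo)%E \/
    (forall t : R, 0 < t -> continuous (transition X P t (cst 1))) ->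
  forall t : R, 0 < t -> strong_feller (transition X P t).
Proof.
move=> E_lc E_sep m_radon m_full HE HR HT [Ft HP] HA RF UC cases t t0 f bf.
have a0 := form_alpha0 HE.
have dense g : sqint m g -> forall e, 0 < e -> exists2 u, C0 u & nrm2 m (u - g) < e.
  by move=> Lg e e0; exact: (C0_L2_dense HE HR).
have c1 : continuous (transition X P t (cst 1)).
  case: cases => [fE|/(_ t t0)//].
  exact: (transition1_continuous E_lc E_sep m_radon m_full a0 HT HP HA RF UC dense).
split; last by have [] := transition_bounded_borel HP (ltW t0) bf.
exact: (transition_continuous E_lc E_sep m_radon m_full a0 HT HP HA RF UC dense).
Qed.
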